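(* Let $\mathcal I$ be the set of all infinitely divisible real random variables $X$ with $E[X^2]<\infty$, and let $\mathcal I_0=\{X\in\mathcal I: \mathrm{Var}(X)>0\}$. Define $$P_{\mathcal I}=\inf_{X\in\mathcal I}P\left\{|X-E[X]|\le \sqrt{\mathrm{Var}(X)}\right\},\qquad P_{\mathcal I_0}=\inf_{X\in\mathcal I_0}P\left\{|X-E[X]|<\sqrt{\mathrm{Var}(X)}\right\}.$$ Then $P_{\mathcal I}\ge P_{\mathcal I_0}>0$. Moreover, there exists $Y\in\mathcal I_0$ such that $P_{\mathcal I_0}=P\{|Y-E[Y]|<\sqrt{\mathrm{Var}(Y)}\}$.
   Context: A real random variable (or its distribution) is infinitely divisible if for every $n\ge1$ its distribution equals that of a sum of $n$ i.i.d. random variables. *)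

(* Defs.v *)
From HB Require Import structures.
From mathcomp Require Import all_boot all_order all_algebra.
From mathcomp Require Import all_classical all_reals all_analysis.
Set Implicit Arguments. Unset Strict Implicit. Unset Printing Implicit Defensive.
Import Order.TTheory GRing.Theory Num.Theory.
Local Open Scope classical_set_scope.
Local Open Scope ring_scope.

(* Mutual independence of a finite family of real random variables:
   P(Y_0 in B_0, ..., Y_{n-1} in B_{n-1}) = prod_i P(Y_i in B_i)
   for all Borel sets B_i (taking B_i = setT recovers every subfamily). *)
Definition mutually_independent {d} {T : measurableType d} {R : realType}
    (Q : probability T R) (n : nat) (Y : 'I_n -> {RV Q >-> R}) : Prop :=
  forall B : 'I_n -> set R, (forall i, measurable (B i)) ->
    fine (Q (\bigcap_(i in [set: 'I_n]) (Y i @^-1` B i)))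
    = \prod_(i < n) fine (Q (Y i @^-1` B i)).

Definition identically_distributed {d} {T : measurableType d} {R : realType}
    (Q : probability T R) (n : nat) (Y : 'I_n -> {RV Q >-> R}) : Prop :=
  forall i j (A : set R), measurable A ->
    Q (Y i @^-1` A) = Q (Y j @^-1` A).

Definition infinitely_divisible {d} {T : measurableType d} {R : realType}
    (P : probability T R) (X : {RV P >-> R}) : Prop :=
  forall n : nat, (1 <= n)%N ->
    exists (d' : measure_display) (T' : measurableType d')
           (Q : probability T' R) (Y : 'I_n -> {RV Q >-> R}),
      mutually_independent Y /\ identically_distributed Y /\
      forall A : set R, measurable A ->
        Q ((fun t => \sum_(i < n) Y i t) @^-1` A) = P (X @^-1` A).

Definition finite_second_moment {d} {T : measurableType d} {R : realType}
    (P : probability T R) (X : {RV P >-> R}) : Prop :=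
  P.-integrable setT (fun t => (X t ^+ 2)%:E).

Definition mean {d} {T : measurableType d} {R : realType}
    (P : probability T R) (X : {RV P >-> R}) : R := fine ('E_P[X]).

Definition var {d} {T : measurableType d} {R : realType}
    (P : probability T R) (X : {RV P >-> R}) : R := fine ('V_P[X]).

Definition PI_values (R : realType) : set R :=
  [set p | exists (d : measure_display) (T : measurableType d)
             (P : probability T R) (X : {RV P >-> R}),
     infinitely_divisible X /\ finite_second_moment X /\
     p = fine (P [set t | `|X t - mean X| <= Num.sqrt (var X)])].

Definition PI0_prob {d} {T : measurableType d} {R : realType}
    (P : probability T R) (X : {RV P >-> R}) : R :=
  fine (P [set t | `|X t - mean X| < Num.sqrt (var X)]).

Definition in_I0 {d} {T : measurableType d} {R : realType}
    (P : probability T R) (X : {RV P >-> R}) : Prop :=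
  infinitely_divisible X /\ finite_second_moment X /\ 0 < var X.

Definition PI0_values (R : realType) : set R :=
  [set p | exists (d : measure_display) (T : measurableType d)
             (P : probability T R) (X : {RV P >-> R}),
     in_I0 X /\ p = PI0_prob X].

Arguments PI_values R : clear implicits.
Arguments PI0_values R : clear implicits.

(* Main.v *)
Require Import Defs.
From HB Require Import structures.
From mathcomp Require Import all_boot all_order all_algebra.
From mathcomp Require Import all_classical all_reals all_analysis.
From mathcomp Require Import measurable_realfun ring lra.
Import Order.TTheory GRing.Theory Num.Theory.
Import numFieldNormedType.Exports.
Local Open Scope classical_set_scope.
Local Open Scope ring_scope.
Set Implicit Arguments. Unset Strict Implicit. Unset Printing Implicit Defensive.

(** Standardize all variables to mean 0 and variance 1, and let m be the infimum
    of P(|X| < 1).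

    Positivity.  Write X = Y1 + Y2 with Y1, Y2 iid, so E Y = 0 and E Y^2 = 1/2.
    Since E (Y -+ 1/2)^2 = 3/4 < 1, the windows (-1/2, 3/2) and (-3/2, 1/2) have
    probability at least 1/4 each.  So either (-1/2, 1/2) has probability at
    least 1/8, or both [1/2, 3/2) and (-3/2, -1/2] do; in each case two
    independent copies add up to a point of (-1, 1) with probability >= 1/64.

    Attainment.  Represent a minimizing sequence by quantile functions q_k on
    (0, 1).  They are bounded in L^2, hence locally bounded by monotonicity, and
    Helly's theorem gives an a.e. limit q along a subsequence.  For each n the
    quantile functions r_k of the n-th roots converge along a further subsequence
    to some r; evaluating at iid uniform U_1, ..., U_n, the sums of the r_k(U_i)
    converge to the sum of the r(U_i), whose law is therefore that of q: the limit
    is infinitely divisible.  Fatou's lemma gives E q = 0, E q^2 <= 1 and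
    P(|q| < 1) <= m.  Some variance s^2 may be lost in the limit, but s <= 1 yields
    P(|q| < s) <= P(|q| < 1) <= m, and s > 0 because m < 1. *)

(** * Convolution powers and infinite divisibility of laws *)

Local Notation law R := (probability R R).

Definition mfun_of d d' (T : measurableType d) (T' : measurableType d') (f : T -> T')
    (mf : measurable_fun setT f) : {mfun T >-> T'} :=
  HB.pack f (isMeasurableFun.Build _ _ _ _ f mf).

Section convolution.
Context {R : realType}.

Definition pair_sum (z : R * R) : R :=
  z.1 + z.2.

Lemma measurable_pair_sum : measurable_fun setT pair_sum.
Proof. by apply: measurable_funD; [exact: measurable_fst|exact: measurable_snd]. Qed.

Definition pair_sum_mfun : {mfun (R * R)%type >-> R} :=
  mfun_of measurable_pair_sum.

Definition convolve (mu nu : law R) : law R := distribution (mu \x nu)%E pair_sum_mfun.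

Definition id_mfun : {mfun R >-> R} := mfun_of (@measurable_id _ R setT).

Fixpoint convpow (nu : law R) (n : nat) : law R :=
  if n is m.+1 then convolve (convpow nu m) nu else \d_(0 : R).

(* The factor c = Q E lets E carry the remaining variables of an independent family. *)
Lemma convolve_joint d (T : measurableType d) (Q : probability T R)
    (X Y : {mfun T >-> R}) (E : set T) (c : \bar R) (mu nu : law R) :
  measurable E ->
  (forall A B : set R, measurable A -> measurable B ->
    Q (X @^-1` A `&` Y @^-1` B `&` E) = mu A * nu B * c)%E ->
  forall C : set R, measurable C ->
    (Q ((fun t => X t + Y t)%R @^-1` C `&` E) = convolve mu nu C * c)%E.
Proof.
move=> mE XY C mC.
have QE : Q E = c.
  have := XY setT setT measurableT measurableT.
  by rewrite !preimage_setT !setTI !probability_setT !mul1e.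
have mXY : measurable_fun setT (fun t => (X t, Y t)).
  by apply/measurable_fun_pair => //; exact: measurable_funPT.
have mS : measurable ((fun t => X t + Y t)%R @^-1` C).
  rewrite -[X in measurable X]setTI.
  by have := measurable_funD (@measurable_funPT _ _ _ _ X) (@measurable_funPT _ _ _ _ Y); apply.
have [c0|c0] := eqVneq c 0%E.
  rewrite c0 mule0; apply/eqP; rewrite eq_le measure_ge0 andbT.
  by rewrite -c0 -QE; apply: le_measure; rewrite ?inE//; exact: measurableI.
have cE : c = (fine c)%:E by rewrite fineK// -QE fin_num_measure.
have c_gt0 : 0 < fine c.
  by rewrite lt_neqAle fine_ge0 -?QE// andbT eq_sym; apply: contra c0 => /eqP h; rewrite cE -QE h.
(* Restrict [Q] to [E], rescale by 1/c and push forward along (X, Y): the result agrees with the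
   product measure on rectangles, hence everywhere. The case c = 0, where this rescaling is
   impossible, was settled above. *)
pose k : {nonneg R} := NngNum (ltW (etrans (invr_gt0 (fine c)) c_gt0)).
pose XY' : {mfun T >-> (R * R)%type} :=
  HB.pack (fun t => (X t, Y t)) (isMeasurableFun.Build _ _ _ _ (fun t => (X t, Y t)) mXY).
pose m' : {measure set _ -> \bar R} := mscale k (pushforward (mrestr Q mE) XY').
have -> : convolve mu nu C = m' mXY (pair_sum_mfun @^-1` C).
  rewrite /convolve /distribution /pushforward.
  have mD : measurable (pair_sum_mfun @^-1` C) by rewrite -[X in measurable X]setTI; exact: measurable_pair_sum.
  apply: (@product_measure_unique _ _ _ _ R mu nu (m' mXY) _ _ mD) => A B mA mB.
  rewrite /m' /=/mscale/pushforward/mrestr/=.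
  rewrite [X in (_ * X)%E](XY A B)// cE /= muleC -muleA -EFinM mulfV ?mule1// gt_eqF//.
rewrite /m' /mscale/pushforward/mrestr/= [X in (_ * X)%E]cE muleAC -EFinM mulVf ?mul1e// gt_eqF//.
Qed.


Lemma convolve_joint0 d (T : measurableType d) (Q : probability T R)
    (X Y : {mfun T >-> R}) (mu nu : law R) :
  (forall A B : set R, measurable A -> measurable B ->
    Q (X @^-1` A `&` Y @^-1` B) = mu A * nu B)%E ->
  forall C : set R, measurable C ->
    (Q ((fun t => X t + Y t)%R @^-1` C) = convolve mu nu C)%E.
Proof.
move=> XY C mC.
have /= := @convolve_joint _ _ Q X Y setT 1%E mu nu measurableT _ C mC.
rewrite setIT mule1; apply => A B mA mB.
by rewrite setIT mule1 XY.
Qed.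

Lemma integral_convolve (mu nu : law R) (f : R -> \bar R) : measurable_fun setT f ->
  (forall x, 0 <= f x)%E ->
  (\int[convolve mu nu]_x f x = \int[mu]_x \int[nu]_y f (x + y)%R)%E.
Proof.
move=> mf f0; rewrite /convolve ge0_integral_distribution//.
rewrite fubini_tonelli1//=; apply: measurableT_comp => //; exact: measurable_pair_sum.
Qed.

Lemma eq_convolve (mu mu' nu nu' : law R) :
  (forall A : set R, measurable A -> mu A = mu' A) ->
  (forall A : set R, measurable A -> nu A = nu' A) ->
  forall A : set R, measurable A -> convolve mu nu A = convolve mu' nu' A.
Proof.
move=> mumu nunu A mA; rewrite /convolve/= /distribution/= /pushforward.
have mD : measurable (pair_sum_mfun @^-1` A) by rewrite -[X in measurable X]setTI; exact: measurable_pair_sum.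
apply: (@product_measure_unique _ _ _ _ R mu nu (mu' \x nu')%E _ _ mD) => B C mB mC.
by rewrite /= product_measure1E// mumu// nunu.
Qed.

Lemma eq_convpow (nu nu' : law R) n :
  (forall A : set R, measurable A -> nu A = nu' A) ->
  forall A : set R, measurable A -> convpow nu n A = convpow nu' n A.
Proof. by move=> h; elim: n => [//|n IH] A mA /=; apply: eq_convolve. Qed.

Lemma convolve_dirac0 (nu : law R) (A : set R) : measurable A ->
  convolve \d_(0 : R) nu A = nu A.
Proof.
move=> mA; pose X : {mfun R >-> R} := cst 0.
pose Y : {mfun R >-> R} := id_mfun.
rewrite -(@convolve_joint0 _ _ nu X Y)//.
  by congr (nu _); apply/seteqP; split => x /=; rewrite add0r.
move=> B C mB mC; rewrite /= diracE; have [B0|B0] := boolP (0 \in B).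
  rewrite mul1e; congr (nu _); apply/seteqP; split => x /=; first by case.
  by move=> Cx; split => //; rewrite inE in B0.
rewrite mul0e (_ : _ `&` _ = set0) ?measure0//.
by apply/seteqP; split => x //= [Bx _]; move: B0; rewrite notin_setE.
Qed.

(** * The law of a sum of i.i.d. variables *)

Section sums.
Context d (T : measurableType d) (Q : probability T R) (n : nat).
Variables (Y : 'I_n -> {RV Q >-> R}) (nu : law R).

Let S (j : nat) (t : T) := \sum_(i < n | (i < j)%N) Y i t.

Let mS j : measurable_fun setT (S j).
Proof.
rewrite /S; under eq_fun do rewrite -big_filter.
by apply: measurable_sum => i; exact: measurable_funPT.
Qed.

Let E (B : 'I_n -> set R) := \bigcap_(i in [set: 'I_n]) (Y i @^-1` B i).

Let mE B : (forall i, measurable (B i)) -> measurable (E B).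
Proof.
move=> mB; apply: fin_bigcap_measurable => // i _; exact: measurable_funPTI.
Qed.

Hypothesis indY : mutually_independent Y.
Hypothesis lawY : forall i (A : set R), measurable A -> Q (Y i @^-1` A) = nu A.

Let QE B : (forall i, measurable (B i)) -> Q (E B) = (\prod_(i < n) fine (nu (B i)))%:E.
Proof.
move=> mB; rewrite -[LHS]fineK; last by rewrite fin_num_measure//; exact: mE.
congr EFin; rewrite indY//; apply: eq_bigr => i _; by rewrite lawY.
Qed.

(** Induction on j. The event [E B] leaves the variables of index below j free, so it is independent
    of their sum; carrying such an event along is what makes the induction close. *)
Let partial j : (j <= n)%N -> forall (A : set R) (B : 'I_n -> set R), measurable A ->
  (forall i, measurable (B i)) -> (forall i : 'I_n, (i < j)%N -> B i = setT) ->
  (Q (S j @^-1` A `&` E B) = convpow nu j A * Q (E B))%E.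
Proof.
elim: j => [_|j IH jn] A B mA mB BT.
  rewrite (_ : S 0 = cst 0); last by apply/funext => t; rewrite /S big_pred0.
  rewrite preimage_cst /= diracE; case: ifPn => _; first by rewrite setTI mul1e.
  by rewrite set0I measure0 mul0e.
pose jo := Ordinal jn.
have SE : S j.+1 = fun t => S j t + Y jo t.
  apply/funext => t; rewrite /S (bigD1 jo)//= addrC; congr (_ + _).
  apply: eq_bigl => i; rewrite -val_eqE /= ltnS [in RHS]ltn_neqAle andbC.
  by [].
pose Sj : {mfun T >-> R} := mfun_of (mS j).
rewrite SE; apply: (@convolve_joint _ _ Q Sj (Y jo)) => //; first exact: mE.
move=> A' B' mA' mB'.
(* The condition on the variable of index j is absorbed into the event, which still leaves the
   indices below j free. *)
pose B1 i := if i == jo then B' else B i.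
have mB1 i : measurable (B1 i) by rewrite /B1; case: ifP.
rewrite -setIA (_ : Y jo @^-1` B' `&` E B = E B1); last first.
  apply/seteqP; split => t.
    by move=> [h1 h2] i _; rewrite /B1; case: eqP => [->//|_]; exact: h2.
  move=> h; split; first by have := h jo I; rewrite /B1 eqxx.
  move=> i _; have := h i I; rewrite /B1; case: eqP => // -> _.
  by rewrite BT// /=.
rewrite (IH (ltnW jn) A' B1)//; last first.
  move=> i ij; rewrite /B1; case: eqP => [iE|_]; first by rewrite iE ltnn in ij.
  by apply: BT; rewrite ltnS ltnW.
rewrite -muleA; congr (_ * _)%E.
rewrite !QE// (bigD1 jo)//= [in RHS](bigD1 jo)//= {1}/B1 eqxx.
rewrite [B jo]BT//= probability_setT mul1r EFinM fineK ?fin_num_measure//; congr (_ * _%:E)%E.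
by apply: eq_bigr => i ij; rewrite /B1 (negbTE ij).
Qed.

Lemma law_sum_iid (A : set R) : measurable A ->
  Q ((fun t => \sum_(i < n) Y i t) @^-1` A) = convpow nu n A.
Proof.
move=> mA; have := partial (leqnn n) mA (B := fun=> setT) (fun=> measurableT) (fun _ _ => erefl).
rewrite (_ : E _ = setT); last by apply/seteqP; split.
rewrite setIT probability_setT mule1 => <-.
have -> // : (fun t => \sum_(i < n) Y i t) = S n.
by apply/funext => t; apply: eq_bigl => i; rewrite ltn_ord.
Qed.

End sums.

(** Each induction step multiplies the space by one more factor R: the new coordinate is the last
    variable, and the earlier ones are read through the first projection. *)
Lemma exists_iid (nu : law R) n :
  exists (d : measure_display) (T : measurableType d) (Q : probability T R)
    (Y : 'I_n -> {RV Q >-> R}), mutually_independent Y /\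
    forall i (A : set R), measurable A -> Q (Y i @^-1` A) = nu A.
Proof.
elim: n => [|n [d [T [Q [Y [indY lawY]]]]]].
  exists _, R, nu, (fun _ => id_mfun); split=> [B mB|[]//].
  by rewrite big_ord0 (_ : \bigcap_i _ = setT) ?probability_setT//; apply/seteqP; split=> // t _ [].
pose Z (i : 'I_n.+1) : {RV (Q \x nu)%E >-> R} :=
  if unlift ord_max i is Some j then 
    mfun_of (measurableT_comp (@measurable_funPT _ _ _ _ (Y j)) measurable_fst)
  else mfun_of measurable_snd.
exists _, (T * R)%type, (Q \x nu)%E, Z; split.
  move=> B mB.
  pose BY := \bigcap_(i in [set: 'I_n]) (Y i @^-1` B (lift ord_max i)).
  have mBY : measurable BY.
    by apply: fin_bigcap_measurable => // i _; exact: measurable_funPTI.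
  have -> : \bigcap_(i in [set: 'I_n.+1]) (Z i @^-1` B i) = BY `*` B ord_max.
    apply/seteqP; split => [[t x] h|[t x] [/= h1 h2] i _].
      split => [i _|].
        by have := h (lift ord_max i) I; rewrite /Z liftK.
      by have := h ord_max I; rewrite /Z unlift_none.
    rewrite /Z; case: unliftP => [j ->|->]//=; exact: h1.
  rewrite /= product_measure1E// fineM ?fin_num_measure// indY// big_ord_recr/=.
  congr (_ * fine _).
    apply: eq_bigr => i _; rewrite (_ : widen_ord _ _ = lift ord_max i); last first.
      by apply/val_inj => /=; rewrite /bump leqNgt ltn_ord.
    rewrite (_ : Z _ @^-1` _ = (Y i @^-1` B (lift ord_max i)) `*` setT); last first.
      by apply/seteqP; split => -[t x] /=; rewrite /Z liftK//= => -[].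
    rewrite product_measure1E//; last exact: measurable_funPTI.
    by rewrite [X in (_ * X)%E](probability_setT nu) mule1.
  rewrite (_ : Z _ @^-1` _ = setT `*` B ord_max); last first.
    by apply/seteqP; split => -[t x] /=; rewrite /Z unlift_none//= => -[].
  by rewrite product_measure1E// [X in (X * _)%E](probability_setT Q) mul1e.
move=> i A mA; rewrite /= /Z; case: unliftP => [j _|_].
  rewrite (_ : _ @^-1` _ = (Y j @^-1` A) `*` setT); last first.
    by apply/seteqP; split => -[t x] //= [].
  rewrite product_measure1E//; last exact: measurable_funPTI.
  by rewrite [X in (_ * X)%E](probability_setT nu) mule1; exact: lawY.
rewrite (_ : _ @^-1` _ = setT `*` A); last first.
  by apply/seteqP; split => -[t x] //= [].
by rewrite product_measure1E// [X in (X * _)%E](probability_setT Q) mul1e.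
Qed.

(* The roots are indexed from n = 0, so [n.+1] is the number of summands. *)
Definition id_law (mu : law R) := forall n, exists nu : law R,
  forall A : set R, measurable A -> mu A = convpow nu n.+1 A.

(** This reduces the notion to laws on R: the law of any one summand is a convolution root, and
    conversely a root is realized by independent copies. *)
Lemma infinitely_divisibleP d (T : measurableType d) (P : probability T R)
    (X : {RV P >-> R}) : infinitely_divisible X <-> id_law (distribution P X).
Proof.
split => [idX n|idX [//|n] _].
  have [d' [T' [Q [Y [indY [eqY sumY]]]]]] := idX n.+1 isT.
  exists (distribution Q (Y ord0)) => A mA; rewrite /= /distribution /pushforward -sumY//.
  by apply: law_sum_iid => // i B mB; exact: eqY.
have [nu nuE] := idX n; have [d' [T' [Q [Y [indY lawY]]]]] := exists_iid nu n.+1.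
exists d', T', Q, Y; split => //; split => [i j A mA|A mA]; first by rewrite !lawY.
by rewrite (law_sum_iid indY lawY)// -nuE.
Qed.

End convolution.

(** * First and second moments *)

Definition m2 d (T : measurableType d) (R : realType) (P : probability T R)
  (X : {RV P >-> R}) : R := fine (\int[P]_t (X t ^+ 2)%:E).

(** The identity of R seen as a random variable of law [mu], so that moments of variables also serve
    for laws. *)
Local Notation lid mu := (id_mfun : {RV mu >-> _}).

Section moments.
Context d (T : measurableType d) (R : realType) (P : probability T R) (X : {RV P >-> R}).

Lemma finite_second_momentP :
  finite_second_moment X <-> (\int[P]_t (X t ^+ 2)%:E < +oo)%E.
Proof.
rewrite /finite_second_moment; split => [/integrableP[_]|h].
  by under eq_integral do rewrite gee0_abs ?lee_fin ?sqr_ge0//.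
apply/integrableP; split.
  by apply/measurable_EFinP; apply: measurable_funX; exact: measurable_funPT.
by under eq_integral do rewrite gee0_abs ?lee_fin ?sqr_ge0//.
Qed.

Hypothesis X2 : finite_second_moment X.

(** Domination by 1 + X^2, as |x| <= 1 + x^2. *)
Lemma integrable_fst_moment : P.-integrable setT (fun t => (X t)%:E).
Proof.
apply: (@le_integrable _ _ _ P setT measurableT _ (fun t => (1 + X t ^+ 2)%:E)%E) => //.
- by apply/measurable_EFinP; exact: measurable_funPT.
- move=> t _ /=; rewrite lee_fin [leRHS]ger0_norm ?addr_ge0 ?sqr_ge0//.
  have := sqr_ge0 (`|X t| - 1); rewrite -(real_normK (num_real (X t))); nra.
- under [X in _.-integrable _ X]eq_fun do rewrite EFinD.
  by apply: integrableD => //; exact: finite_measure_integrable_cst.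
Qed.

Lemma integral_quad (a b c : R) :
  (\int[P]_t (a * X t ^+ 2 + b * X t + c)%:E = (a * m2 X + b * mean X + c)%:E)%E.
Proof.
have X1 := integrable_fst_moment.
have i2 : P.-integrable setT (fun t => (a * X t ^+ 2)%:E).
  by under [X in _.-integrable _ X]eq_fun do rewrite EFinM; exact: integrableZl.
have i1 : P.-integrable setT (fun t => (b * X t)%:E).
  by under [X in _.-integrable _ X]eq_fun do rewrite EFinM; exact: integrableZl.
have i0 : P.-integrable setT (fun t => c%:E) by exact: finite_measure_integrable_cst.
under eq_integral do rewrite !EFinD.
rewrite integralD//; last by exact: integrableD.
rewrite integralD// integral_cst// [X in (_ + _ * X)%E](probability_setT P) mule1.
under eq_integral do rewrite EFinM.
rewrite integralZl// [RHS]EFinD [in RHS]EFinD; congr (_ + _ + _)%E.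
  by rewrite /m2 EFinM fineK//; exact: integrable_fin_num.
under eq_integral do rewrite EFinM.
by rewrite integralZl// /mean unlock EFinM fineK//; exact: integrable_fin_num.
Qed.

Lemma varE : var X = m2 X - mean X ^+ 2.
Proof.
have mE : mean X = fine (\int[P]_w (X w)%:E) by rewrite /mean unlock.
rewrite /var /variance unlock unlock -mE.
under eq_integral.
  move=> t _; rewrite (_ : (_ * _)%R t = 1 * X t ^+ 2 + (- 2 * mean X) * X t + mean X ^+ 2); last first.
    rewrite [LHS](_ : _ = (X t - mean X) * (X t - mean X))//; ring.
  over.
by rewrite integral_quad /=; ring.
Qed.

End moments.

(** * Moments of convolutions *)

Section conv_moments.
Context {R : realType}.

(** By Tonelli the integral of (x + y)^2 in y is finite for at least one x; for that x, the bound
    y^2 <= 2 (x + y)^2 + 2 x^2 concludes. *)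
Lemma sqr_integrable_of_convolve (mu nu : law R) :
  finite_second_moment (lid (convolve mu nu)) -> finite_second_moment (lid nu).
Proof.
move=> /finite_second_momentP /=; rewrite integral_convolve//; last first.
- by move=> x; rewrite lee_fin sqr_ge0.
- by apply/measurable_EFinP; exact: measurable_funX.
move=> foo; apply/finite_second_momentP => /=.
have [x xoo] : exists x, (\int[nu]_y ((x + y) ^+ 2)%:E < +oo)%E.
  apply/not_existsP => h; move: foo.
  under eq_integral.
    move=> x _; rewrite (_ : (\int[nu]_y _)%E = +oo%E); last first.
      by apply/eqP; rewrite eq_le leey /= leNgt; apply/negP/h.
    over.
  by rewrite integral_cst//= [X in (_ * X)%E](probability_setT mu) mule1.
pose f y : \bar R := (2 * (x + y) ^+ 2 + 2 * x ^+ 2)%:E.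
apply: (@le_lt_trans _ _ (\int[nu]_y f y)%E).
  apply: ge0_le_integral => //.
  - by move=> y _; rewrite lee_fin sqr_ge0.
  - by apply/measurable_EFinP; exact: measurable_funX.
  - apply/measurable_EFinP; apply: measurable_funD => //; apply: measurable_funM => //.
    by apply: measurable_funX; exact: measurable_funD.
  - by move=> y _; rewrite lee_fin; have := sqr_ge0 (2 * x + y); nra.
pose S : {RV nu >-> R} := mfun_of (measurable_funD (@measurable_cst _ _ _ _ _ x) (@measurable_id _ R setT)).
have S2 : finite_second_moment S by apply/finite_second_momentP.
have := integral_quad S2 2 0 (2 * x ^+ 2) => /=.
under eq_integral do rewrite mul0r addr0.
by rewrite /f => ->; rewrite ltry.
Qed.

Lemma sqr_integrable_of_convolvel (mu nu : law R) :
  finite_second_moment (lid (convolve mu nu)) -> finite_second_moment (lid mu).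
Proof.
move=> h; apply: (@sqr_integrable_of_convolve nu mu); apply/finite_second_momentP => /=.
move/finite_second_momentP : h => /=; rewrite !integral_convolve//.
- rewrite (fubini_tonelli (fun z : R * R => ((z.1 + z.2) ^+ 2)%:E))//=.
  + by under eq_integral do under eq_integral do rewrite addrC.
  + by apply/measurable_EFinP; apply: measurable_funX; exact: measurable_pair_sum.
  + by move=> z; rewrite lee_fin sqr_ge0.
- by apply/measurable_EFinP; exact: measurable_funX.
- by move=> x; rewrite lee_fin sqr_ge0.
- by apply/measurable_EFinP; exact: measurable_funX.
- by move=> x; rewrite lee_fin sqr_ge0.
Qed.

Section add.
Variables mu nu : law R.
Hypothesis mu2 : finite_second_moment (lid mu).
Hypothesis nu2 : finite_second_moment (lid nu).

Let m (P : law R) := mean (lid P).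
Let s (P : law R) := m2 (lid P).

(** The integrand is nonnegative, so Tonelli applies directly. The shift a = 0 yields the second
    moment, and a = 1 then yields the mean. *)
Let shifted (a : R) : (\int[convolve mu nu]_x ((x + a) ^+ 2)%:E =
  (s mu + 2 * m mu * m nu + s nu + 2 * a * (m mu + m nu) + a ^+ 2)%:E)%E.
Proof.
rewrite integral_convolve; last 2 first.
- by apply/measurable_EFinP; apply: measurable_funX; exact: measurable_funD.
- by move=> x; rewrite lee_fin sqr_ge0.
under eq_integral.
  move=> x _; under eq_integral.
    move=> y _; rewrite (_ : (_ ^+ 2) = 1 * (lid nu) y ^+ 2 + (2 * (x + a)) * (lid nu) y + (x + a) ^+ 2); last first.
      by rewrite /=; ring.
    over.
  rewrite (integral_quad nu2).
  rewrite -/(s nu) -/(m nu) (_ : (_ + _) = 1 * (lid mu) x ^+ 2 + (2 * m nu + 2 * a) * (lid mu) x + (s nu + 2 * a * m nu + a ^+ 2)); last first.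
    by rewrite /=; ring.
  over.
by rewrite (integral_quad mu2) -/(s mu) -/(m mu); congr EFin; ring.
Qed.

Lemma sqr_integrable_convolve : finite_second_moment (lid (convolve mu nu)).
Proof.
apply/finite_second_momentP => /=; have := shifted 0.
by under eq_integral do rewrite addr0; move=> ->; rewrite ltry.
Qed.

Lemma m2_convolve : m2 (lid (convolve mu nu)) =
  m2 (lid mu) + 2 * mean (lid mu) * mean (lid nu) + m2 (lid nu).
Proof.
have := shifted 0; rewrite {1}/m2 /=.
under eq_integral do rewrite addr0.
by move=> ->; rewrite /s /m /=; ring.
Qed.

Lemma mean_convolve : mean (lid (convolve mu nu)) = mean (lid mu) + mean (lid nu).
Proof.
(* Expanding (x + 1)^2 = x^2 + 2 x + 1 isolates the mean, since the second moment is already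
   known. *)
have := shifted 1; under eq_integral.
  move=> x _; rewrite (_ : (_ ^+ 2) = 1 * (lid (convolve mu nu)) x ^+ 2 + 2 * (lid (convolve mu nu)) x + 1); last by rewrite /=; ring.
  over.
rewrite (integral_quad sqr_integrable_convolve) m2_convolve => -[]; rewrite -/(s mu) -/(m mu) -/(s nu) -/(m nu).
by move=> h; lra.
Qed.

End add.

Lemma eq_law_moments (mu nu : law R) : (forall A, measurable A -> mu A = nu A) ->
  [/\ finite_second_moment (lid mu) -> finite_second_moment (lid nu),
      m2 (lid mu) = m2 (lid nu) & mean (lid mu) = mean (lid nu)].
Proof.
move=> mn.
have e (f : R -> \bar R) : (\int[mu]_x f x = \int[nu]_x f x)%E.
  by apply: eq_measure_integral => A mA _; exact: mn.
split; last 2 first.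
- by rewrite /m2 e.
- by rewrite /mean unlock e.
by move=> /finite_second_momentP h; apply/finite_second_momentP; rewrite -e.
Qed.

(** Square integrability descends from the power to its root. The coefficient of the squared mean
    counts ordered pairs of distinct summands. *)
Lemma moments_convpow (nu : law R) n : finite_second_moment (lid (convpow nu n.+1)) ->
  [/\ finite_second_moment (lid nu),
      mean (lid (convpow nu n.+1)) = n.+1%:R * mean (lid nu) &
      m2 (lid (convpow nu n.+1)) = n.+1%:R * m2 (lid nu) + (n.+1 * n)%:R * mean (lid nu) ^+ 2].
Proof.
elim: n => [|n IH] h.
  have [nu2 e2 e1] := eq_law_moments (convolve_dirac0 nu).
  split; first exact: nu2.
  - by rewrite e1 mul1r.
  - by rewrite e2 mul1r mul1n mul0r addr0.
have [nu2 e1 e2] := IH (sqr_integrable_of_convolvel h).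
split => //; rewrite [convpow _ _]/(convolve (convpow nu n.+1) nu).
  by rewrite mean_convolve ?e1//; [rewrite -[in RHS]natr1; ring|exact: sqr_integrable_of_convolvel h].
rewrite m2_convolve ?e2 ?e1//; last exact: sqr_integrable_of_convolvel h.
by rewrite !natrM -!natr1; ring.
Qed.

End conv_moments.

(** * The lower bound 1/64 *)

Lemma measurable_lt_set d (T : measurableType d) (R : realType) (f g : T -> R) :
  measurable_fun setT f -> measurable_fun setT g -> measurable [set t | f t < g t].
Proof.
move=> mf mg; have /(_ measurableT [set true]) := measurable_fun_ltr mf mg.
by rewrite setTI; exact.
Qed.

Lemma measurable_le_set d (T : measurableType d) (R : realType) (f g : T -> R) :
  measurable_fun setT f -> measurable_fun setT g -> measurable [set t | f t <= g t].
Proof.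
move=> mf mg; have /(_ measurableT [set true]) := measurable_fun_ler mf mg.
by rewrite setTI; exact.
Qed.

Section normalized.
Context {R : realType}.

Lemma convolve_ge (mu nu : law R) (U V D : set R) :
  measurable U -> measurable V -> measurable D ->
  (forall x y, U x -> V y -> D (x + y)) -> (mu U * nu V <= convolve mu nu D)%E.
Proof.
move=> mU mV mD UVD; rewrite -product_measure1E//; apply: le_measure; rewrite ?inE.
- exact: measurableX.
- by rewrite -[X in measurable X]setTI; exact: measurable_pair_sum.
- by move=> [x y] [/= Ux Vy]; exact: UVD.
Qed.

(* Integrate the pointwise bound [1 <= (x - c)^2 + 1_((x - c)^2 < 1)]. *)
Lemma quarter_le_window (nu : law R) (c : R) :
  finite_second_moment (lid nu) -> mean (lid nu) = 0 -> m2 (lid nu) = 2^-1 ->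
  c ^+ 2 = 4^-1 -> 4^-1 <= fine (nu [set x | (x - c) ^+ 2 < 1]).
Proof.
move=> nu2 nu0 nu1 cE; pose I := [set x : R | (x - c) ^+ 2 < 1].
have mq : measurable_fun setT (fun x : R => (x - c) ^+ 2).
  by apply: measurable_funX; exact: measurable_funB.
have mI : measurable I.
  exact: measurable_lt_set.
have : (\int[nu]_x 1 <= \int[nu]_x (((x - c) ^+ 2)%:E + (\1_I x)%:E))%E.
  apply: ge0_le_integral => //.
  - by apply: emeasurable_funD; apply/measurable_EFinP.
  - move=> x _; rewrite -EFinD lee_fin indicE; case: (boolP (x \in I)) => [_|].
      by rewrite lerDr sqr_ge0.
    by rewrite notin_setE /= => /negP; rewrite -leNgt addr0.
rewrite integral_cst// mul1e [X in (X <= _)%E](probability_setT nu).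
rewrite ge0_integralD//=; last 3 first.
- by move=> x _; rewrite lee_fin sqr_ge0.
- exact/measurable_EFinP.
- exact/measurable_EFinP.
rewrite integral_indic// setIT.
under eq_integral.
  move=> x _; rewrite (_ : _ ^+ 2 = 1 * (lid nu) x ^+ 2 + (- 2 * c) * (lid nu) x + c ^+ 2); last by rewrite /=; ring.
  over.
rewrite (integral_quad nu2) nu0 nu1 cE .
rewrite -[X in (_ <= _ + X)%E]fineK ?fin_num_measure//.
by rewrite -EFinD lee_fin; lra.
Qed.

Lemma normalized_id_ge (mu : law R) : id_law mu -> finite_second_moment (lid mu) ->
  mean (lid mu) = 0 -> m2 (lid mu) = 1 -> 64^-1 <= fine (mu `]-1, 1[%classic).
Proof.
move=> idmu mu2 mu0 mu1; have [nu nuE] := idmu 1%N.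
have [h2 e2 e1] := eq_law_moments nuE.
have [nu2 E1 E2] := moments_convpow (h2 mu2).
have nu0 : mean (lid nu) = 0 by move: E1; rewrite -e1 mu0 => /esym/eqP; rewrite mulf_eq0 => /orP[/eqP|/eqP//]; lra.
have nu1 : m2 (lid nu) = 2^-1 by move: E2; rewrite -e2 mu1 nu0; lra.
have pE (U V : set R) : measurable U -> measurable V ->
    (forall x y, U x -> V y -> (-1 < x + y < 1)) ->
    fine (nu U) * fine (nu V) <= fine (mu `]-1, 1[%classic).
  move=> mU mV UV; rewrite -fineM ?fin_num_measure// fine_le ?fin_numM ?fin_num_measure//.
  rewrite nuE// [leRHS](_ : _ = convolve nu nu `]-1, 1[%classic); last first.
    by apply: eq_convolve => // B mB; exact: convolve_dirac0.
  by apply: convolve_ge => // x y Ux Vy; rewrite /= in_itv/=; exact: UV.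
(* [A] is the overlap of the windows (-1/2, 3/2) and (-3/2, 1/2), while [B] and [C] are what is left
   of each. Both A + A and B + C lie in (-1, 1). *)
pose A := `](-2^-1 : R), 2^-1[%classic.
pose B := `[(2^-1 : R), 3/2[%classic.
pose C := `](-(3/2) : R), -2^-1]%classic.
have mA : measurable A by exact: measurable_itv.
have mB : measurable B by exact: measurable_itv.
have mC : measurable C by exact: measurable_itv.
have pA : fine (nu A) * fine (nu A) <= fine (mu `]-1, 1[%classic).
  by apply: pE => // x y; rewrite /A /= !in_itv/= => /andP[? ?] /andP[? ?]; apply/andP; split; lra.
have pBC : fine (nu B) * fine (nu C) <= fine (mu `]-1, 1[%classic).
  by apply: pE => // x y; rewrite /B/C /= !in_itv/= => /andP[? ?] /andP[? ?]; apply/andP; split; lra.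
have cover (c : R) (D : set R) : measurable D -> [set x : R | (x - c) ^+ 2 < 1] `<=` A `|` D ->
    c ^+ 2 = 4^-1 -> 4^-1 <= fine (nu A) + fine (nu D).
  move=> mD sub c2; have mW : measurable [set x : R | (x - c) ^+ 2 < 1].
    by apply: measurable_lt_set => //; apply: measurable_funX; exact: measurable_funB.
  apply: (le_trans (quarter_le_window nu2 nu0 nu1 c2)).
  rewrite -fineD ?fin_num_measure// fine_le ?fin_numD ?fin_num_measure//.
  apply: (le_trans (le_measure _ _ _ sub)); rewrite ?inE ?measureU2//; last exact: measurableU.
have hB : 4^-1 <= fine (nu A) + fine (nu B).
  apply: (cover 2^-1) => //; last by field.
  move=> x /= h; have {h} : -2^-1 < x < 3/2 by apply/andP; split; nra.
  rewrite /A/B/= !in_itv/= => /andP[h1 h2']; have [?|?] := ltP x 2^-1; [left|right]; apply/andP; split; lra.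
have hC : 4^-1 <= fine (nu A) + fine (nu C).
  apply: (cover (-2^-1)) => //; last by field.
  move=> x /= h; have {h} : -(3/2) < x < 2^-1 by apply/andP; split; nra.
  rewrite /A/C/= !in_itv/= => /andP[h1 h2']; have [?|?] := leP x (-2^-1); [right|left]; apply/andP; split; lra.
(* If [A] has mass below 1/8, then [B] and [C] each have mass above 1/8; either way one of [pA],
   [pBC] gives 1/64. *)
by have [?|?] := leP 8^-1 (fine (nu A)); nra.
Qed.

End normalized.

(** * Deviations from the mean: zero and positive variance *)

Section degenerate.
Context d (T : measurableType d) (R : realType) (P : probability T R) (X : {RV P >-> R}).
Hypothesis X2 : finite_second_moment X.

Let centered_sqr : (\int[P]_t ((X t - mean X) ^+ 2)%:E = (var X)%:E)%E.
Proof.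
rewrite varE//; under eq_integral.
  move=> t _; rewrite (_ : _ ^+ 2 = 1 * X t ^+ 2 + (- 2 * mean X) * X t + mean X ^+ 2); last ring.
  over.
by rewrite integral_quad//; congr EFin; ring.
Qed.

Let mX : measurable_fun setT (fun t => X t - mean X).
Proof. by apply: measurable_funB => //; exact: measurable_funPT. Qed.

Lemma var_ge0 : 0 <= var X.
Proof. by rewrite -lee_fin -centered_sqr integral_ge0// => t _; rewrite lee_fin sqr_ge0. Qed.

Lemma measurable_dev_lt (c : R) : measurable [set t | `|X t - mean X| < c].
Proof.
by apply: measurable_lt_set => //; exact: measurableT_comp.
Qed.

Lemma measurable_dev_le (c : R) : measurable [set t | `|X t - mean X| <= c].
Proof.
by apply: measurable_le_set => //; exact: measurableT_comp.
Qed.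

(** The squared deviation is nonnegative with integral 0, so it vanishes almost everywhere. *)
Lemma var0_dev : var X = 0 -> P [set t | `|X t - mean X| <= 0] = 1%E.
Proof.
move=> v0; have : ae_eq P setT (fun t => ((X t - mean X) ^+ 2)%:E) (cst 0%E).
  apply/ae_eq_integral_abs => //; first by apply/measurable_EFinP; exact: measurable_funX.
  by under eq_integral do rewrite gee0_abs ?lee_fin ?sqr_ge0//; rewrite centered_sqr v0.
move=> h.
have mD := measurable_dev_le 0.
have N0 : P (~` [set t | `|X t - mean X| <= 0]) = 0%E.
  apply/negligibleP; first exact: measurableC.
  apply: negligibleS h => t /= ht /(_ I) [] /eqP; rewrite sqrf_eq0 => /eqP tE.
  by apply: ht; rewrite tE normr0.
by rewrite -[X in P X]setCK probability_setC ?N0 ?sube0//; exact: measurableC.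
Qed.

(** Otherwise var X - (X - E X)^2 would be almost surely positive while its integral is var X - var
    X = 0. *)
Lemma PI0_prob_lt1 : 0 < var X -> PI0_prob X < 1.
Proof.
move=> v0; rewrite ltNge; apply/negP => h.
pose D := [set t | `|X t - mean X| < Num.sqrt (var X)].
have mD : measurable D by exact: measurable_dev_lt.
have PD : P D = 1%E.
  apply/eqP; rewrite eq_le probability_le1//= -[P D]fineK ?fin_num_measure// lee_fin.
have PDC : P (~` D) = 0%E by rewrite probability_setC// [X in (_ - X)%E]PD subee.
have Dlt t : D t -> (X t - mean X) ^+ 2 < var X.
  rewrite /D/= => Dt; rewrite -real_normK ?num_real// -[ltRHS]sqr_sqrtr ?ltW//.
  by rewrite ltr_pXn2r// ?nnegrE ?sqrtr_ge0.
have mf : measurable_fun setT (fun t => (X t - mean X) ^+ 2) by exact: measurable_funX.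
have e1 : (\int[P]_t ((var X)%:E * (\1_D t)%:E) = (var X)%:E)%E.
  rewrite ge0_integralZl//; last by rewrite lee_fin ltW.
    by rewrite integral_indic// setIT [X in (_ * X)%E]PD mule1.
  exact/measurable_EFinP.
(* The indicator makes the integrand nonnegative everywhere: it is the variance minus the squared
   deviation on [D], and 0 elsewhere. *)
have : ae_eq P setT (fun t => ((var X * \1_D t - (X t - mean X) ^+ 2) * \1_D t)%:E) (cst 0%E).
  have aeq : ae_eq P setT (fun t => ((X t - mean X) ^+ 2)%:E) (fun t => ((X t - mean X) ^+ 2 * \1_D t)%:E).
    exists (~` D); split => //; first exact: measurableC.
    move=> t /= ht Dt; apply: ht => _; by rewrite indicE mem_set// mulr1.
  apply/ae_eq_integral_abs => //.
    apply/measurable_EFinP; apply: measurable_funM => //; apply: measurable_funB => //.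
    by apply: measurable_funM.
  under eq_integral.
    move=> t _; rewrite gee0_abs; last first.
      rewrite lee_fin indicE; case: (boolP (t \in D)) => [|_]; last by rewrite mulr0.
      by rewrite inE => /Dlt; rewrite !mulr1 subr_ge0 => /ltW.
    rewrite (_ : (_ * _)%R = var X * \1_D t - (X t - mean X) ^+ 2 * \1_D t); last first.
      by rewrite indicE; case: (t \in D); rewrite ?(mulr1,mulr0,subr0,mul0r).
    rewrite EFinB [(var X * _)%:E]EFinM.
    over.
  have i1 : P.-integrable setT (fun t => (var X)%:E * (\1_D t)%:E)%E.
    by apply: integrableZl => //; exact: integrable_indic.
  have i2 : P.-integrable setT (fun t => ((X t - mean X) ^+ 2 * \1_D t)%:E).
    apply: (le_integrable _ _ _ i1) => //.
      by apply/measurable_EFinP; exact: measurable_funM.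
    move=> t _; rewrite /= lee_fin indicE; case: (boolP (t \in D)); rewrite ?mulr0 ?mulr1//.
    by rewrite inE => /Dlt /ltW h'; rewrite !ger0_norm ?sqr_ge0// ltW.
  rewrite integralB// e1 -(ae_eq_integral _ _ _ _ _ aeq)//.
  - by rewrite centered_sqr subee.
  - exact/measurable_EFinP.
  - by apply/measurable_EFinP; exact: measurable_funM.
move=> h0.
have : P D = 0%E.
  apply/negligibleP => //; apply: negligibleS h0 => t /= Dt /(_ I) [] /eqP.
  rewrite indicE mem_set// !mulr1 => /eqP ht; have := Dlt _ Dt; lra.
by rewrite PD => /eqP; rewrite onee_eq0.
Qed.

End degenerate.

(** * Helly selection for monotone functions on (0,1) *)

Definition unif (R : realType) : probability (measurableTypeR R) R :=
  uniform_prob (@ltr01 R).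

Section unif.
Context {R : realType}.

Lemma unifE (A : set R) : measurable A ->
  unif R A = lebesgue_measure (A `&` `[0, 1]%classic).
Proof.
move=> mA; rewrite /unif /= /uniform_prob integral_uniform_pdf.
have mA1 : measurable (A `&` `[0, 1]%classic : set (measurableTypeR R)).
  by apply: measurableI => //; exact: measurable_itv.
rewrite (eq_integral (cst 1%E)); last first.
  move=> x; rewrite inE /= in_itv/= => -[_ x01].
  by rewrite /uniform_pdf x01 subr0 invr1.
by rewrite integral_cst// mul1e.
Qed.

Lemma unif_countable (A : set R) : countable A -> (unif R).-negligible A.
Proof.
move=> cA; have mA : measurable (A : set (measurableTypeR R)) by exact: countable_measurable.
apply/negligibleP => //; apply: (etrans (unifE mA)); apply/eqP; rewrite eq_le measure_ge0 andbT.
rewrite -(countable_lebesgue_measure0 cA); apply: le_measure; rewrite ?inE//.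
by apply: measurableI => //; exact: measurable_itv.
Qed.

Lemma unif_ray (c : R) : 0 <= c <= 1 -> unif R `]-oo, c]%classic = c%:E.
Proof.
move=> /andP[c0 c1]; rewrite unifE//.
rewrite (_ : _ `&` _ = `[0, c]%classic); last first.
  apply/seteqP; split => x /=; rewrite !in_itv/=; first by move=> [-> /andP[->]].
  by move=> /andP[-> xc]; rewrite xc (le_trans xc c1).
rewrite lebesgue_measure_itv/= lte_fin; case: ltP => [_|h]; first by rewrite -EFinD subr0.
by congr EFin; apply/eqP; rewrite eq_le c0 h.
Qed.

Lemma ae_unif01 : {ae unif R, forall u : R, 0 < u < 1}.
Proof.
have h : (unif R).-negligible [set u : R | ~ (0 <= u <= 1)].
  have mA : measurable (~` `[0, 1]%classic : set (measurableTypeR R)).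
    by apply: measurableC; exact: measurable_itv.
  exists (~` `[0, 1]%classic); split => //; first by apply: (etrans (unifE mA)); rewrite setICl measure0.
have h2 : (unif R).-negligible [set 0; 1].
  by apply: unif_countable; apply: finite_set_countable; exact: finite_set2.
apply: negligibleS (negligibleU h h2) => u /= hu.
have [u01|] := boolP (0 <= u <= 1); last by left; exact/negP.
right; move/andP : u01 => [u0 u1].
have [->|nu0] := eqVneq u 0; first by left.
have [->|nu1] := eqVneq u 1; first by right.
by exfalso; apply: hu; rewrite !lt_neqAle eq_sym nu0 u0 nu1 u1.
Qed.

(** The endpoints are excluded because a quantile function may be unbounded near 0 and 1. *)
Definition mono01 (f : R -> R) :=
  forall u v : R, 0 < u -> u <= v -> v < 1 -> f u <= f v.

(** Within (0, 1) the preimage of a ray [r, +oo) is an interval; outside, where f = 0, it is the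
    whole complement of (0, 1) or empty, according to the sign of r. *)
Lemma measurable_mono01 (f : R -> R) : mono01 f ->
  (forall u, ~ (0 < u < 1) -> f u = 0) ->
  measurable_fun (setT : set (measurableTypeR R)) f.
Proof.
move=> fm f0.
apply: (measurability (@RGenCInfty.G R)) => [|/= _ [_] [r] -> <-].
  exact: RGenCInfty.measurableE.
rewrite setTI.
rewrite (_ : _ @^-1` _ = [set u | 0 < u < 1 /\ r <= f u] `|`
    (if r <= 0 then ~` `]0, 1[%classic else set0)); last first.
  apply/seteqP; split => u /=; rewrite in_itv/= andbT.
    move=> ru; have [u01|/negP nu] := boolP (0 < u < 1); first by left.
    by right; move: ru; rewrite f0// => -> /=; rewrite in_itv.
  by move=> [[]//|]; case: ifP => //= r0; rewrite in_itv/= => nu; rewrite f0.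
apply: measurableU; last first.
  case: ifP => // _; apply: measurableC; exact: measurable_itv.
apply: is_interval_measurable => s t /= [/andP[s0 s1] rs] [/andP[t0 t1] rt] u /andP[su ut].
have u0 := lt_le_trans s0 su; have u1 := le_lt_trans ut t1.
by rewrite u0 u1; split => //; apply: (le_trans rs); exact: fm.
Qed.

(** Compactness of [-B, B] provides a cluster point, and along an ultrafilter a cluster point is a
    limit. *)
Lemma ultra_lim (U : set_system nat) (a : nat -> R) (B : R) : UltraFilter U ->
  (forall k, `|a k| <= B) -> exists l : R, forall e : R, 0 < e -> U [set k | `|a k - l| < e].
Proof.
move=> UU aB; have PF : ProperFilter (a @ U) by exact: fmap_proper_filter.
have cB := @segment_compact R (- B) B.
have [|l [_ cl]] := cB (a @ U) PF.
  apply: (@filterS _ U _ setT); last exact: filterT.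
  by move=> k _ /=; rewrite in_itv/= -ler_norml.
exists l => e e0; have [//|UC] := in_ultra_setVsetC [set k | `|a k - l| < e] UU.
have /(_ _ _) := cl (a @` (~` [set k | `|a k - l| < e])) (ball l e).
have h1 : (a @ U) (a @` (~` [set k | `|a k - l| < e])).
  by apply: (@filterS _ U _ (~` [set k | `|a k - l| < e])) UC => k hk; exists k.
move=> /(_ h1 (nbhsx_ballx l e e0)) [_ [[k /= hk <-]]].
by rewrite /ball /= distrC => /hk.
Qed.

Let U_bigcap (U : set_system nat) (A : nat -> set nat) j : Filter U ->
  (forall i, U (A i)) -> U [set k | forall i, (i < j)%N -> A i k].
Proof.
move=> FU UA; elim: j => [|j IH]; first by apply: filterS filterT.
apply: filterS (filterI IH (UA j)) => k [/= h1 h2] i; rewrite ltnS leq_eqVlt.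
by move=> /orP[/eqP->//|]; exact: h1.
Qed.

(** The pointwise limit q along an ultrafilter is monotone. A true subsequence is then chosen to
    converge to q at the rationals of (0, 1), and monotonicity extends the convergence to all points
    of (0, 1) but countably many. *)
Lemma helly (q_ : nat -> R -> R) : (forall k, mono01 (q_ k)) ->
  (forall u : R, 0 < u < 1 -> exists B : R, forall k, `|q_ k u| <= B) ->
  exists (phi : nat -> nat) (q : {mfun measurableTypeR R >-> R}),
    [/\ forall j, (j <= phi j)%N, mono01 q &
     {ae unif R, forall u : R, q_ (phi j) u @[j --> \oo] --> (q u : R)}].
Proof.
move=> qm qB.
(* Limits along an ultrafilter exist at every point simultaneously, which
   replaces the diagonal extraction. *)
have [U [UU sU]] := ultraFilterLemma (eventually_filter).
have /choice[g gP] : forall u : R, exists l : R, 0 < u < 1 -> forall e : R, 0 < e ->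
    U [set k | `|q_ k u - l| < e].
  move=> u; have [u01|_] := boolP (0 < u < 1); last by exists 0.
  by have [B hB] := qB u u01; have [l hl] := ultra_lim UU hB; exists l.
pose q (u : R) : R := if 0 < u < 1 then g u else 0.
have qP (u : R) : 0 < u < 1 -> forall e : R, 0 < e -> U [set k | `|q_ k u - q u| < e].
  by move=> u01; rewrite /q u01; exact: gP.
have mq : mono01 q.
  move=> u v u0 uv v1; rewrite leNgt; apply/negP => vu.
  have u01 : 0 < u < 1 by rewrite u0 (le_lt_trans uv v1).
  have v01 : 0 < v < 1 by rewrite v1 (lt_le_trans u0 uv).
  have e0 : 0 < (q u - q v) / 2 by lra.
  have [k [/= h1 h2]] := filter_ex (filterI (qP u u01 _ e0) (qP v v01 _ e0)).
  have := qm k u v u0 uv v1; move: h1 h2; rewrite !ltr_norml => /andP[? ?] /andP[? ?]; lra.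
(* An enumeration of the rationals; the default 0 lies outside (0, 1), so it imposes no condition in
   the choice of [phi]. *)
pose r i : R := if unpickle i is Some x then ratr (x : rat) else 0.
(* Stage j asks for precision 1/(j+1) at the first j + 1 rationals and for an index at least j.
   These are finitely many sets of the ultrafilter, which contains all tails, so they have a common
   point. *)
have /choice[phi phiP] : forall j, exists k, (j <= k)%N /\ forall i, (i < j.+1)%N ->
    0 < r i < 1 -> `|q_ k (r i) - q (r i)| < j.+1%:R^-1.
  move=> j; have h : U [set k | forall i, (i < j.+1)%N -> 0 < r i < 1 ->
      `|q_ k (r i) - q (r i)| < j.+1%:R^-1].
    apply: (@U_bigcap U (fun i => [set k | 0 < r i < 1 ->
      `|q_ k (r i) - q (r i)| < j.+1%:R^-1])) => i.
    have [r01|r01] := boolP (0 < r i < 1); last by apply: filterS filterT => k _.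
    have j0 : 0 < j.+1%:R^-1 :> R by rewrite invr_gt0.
    by apply: filterS (qP _ r01 _ j0) => k hk _.
  have Uj : U [set k | (j <= k)%N] by apply: sU; exists j.
  by have [k [/= h1 h2]] := filter_ex (filterI Uj h); exists k.
have mQ : measurable_fun (setT : set (measurableTypeR R)) q.
  apply: measurable_mono01 => // u; by rewrite /q => /negP/negbTE->.
exists phi, (mfun_of mQ); split => //; first by move=> j; have [] := phiP j.
have conv_rat (x : rat) : (0 < (ratr x : R) < 1) -> forall e : R, 0 < e ->
    \forall j \near \oo, `|q_ (phi j) (ratr x) - q (ratr x)| < e.
  move=> x01 e e0; near=> j.
  have [_ /(_ (pickle x))] := phiP j; rewrite /r pickleK => h.
  have /h /(_ x01) : (pickle x < j.+1)%N by rewrite ltnS; near: j; exact: nbhs_infty_ge.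
  move=> /lt_trans; apply.
  near: j; exact: near_infty_natSinv_lt (PosNum e0).
(* q_ (phi j) converges to q off the sets N t, t rational: if u is not in N t then
   t fails to separate the values of q on the two sides of u. *)
pose N (t : R) := [set u | [/\ 0 < u < 1, forall s, 0 < s -> s < u -> q s < t &
    forall s, u < s -> s < 1 -> t < q s]].
have N0 : (unif R).-negligible (\bigcup_i N (r i)).
  apply: negligible_bigcup => i; apply: unif_countable; apply: finite_set_countable.
  have [[u Nu]|nN] := pselect (exists u, N (r i) u); last first.
    rewrite (_ : N _ = set0)//; apply/seteqP; split => // u Nu; apply: nN; by exists u.
  apply: (@sub_finite_set _ _ [set u]) => // v Nv /=; apply/eqP; rewrite eq_le !leNgt.
  (* With two points a < b in the same set, q at their midpoint would be both above and below [r i];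
     so each set has at most one point. *)
  have nlt a b : N (r i) a -> N (r i) b -> a < b -> False.
    move=> [/andP[a0 a1] _ ha] [/andP[b0 b1] hb _] ab.
    have /andP[m1 m2] : a < (a + b) / 2 < b by apply/andP; split; lra.
    have := ha _ m1 (lt_trans m2 b1); have := hb _ (lt_trans a0 m1) m2.
    by move=> h1 h2; have := lt_trans h1 h2; rewrite ltxx.
  by apply/andP; split; apply/negP; [exact: nlt|exact: nlt].
apply: negligibleS (negligibleU ae_unif01 N0) => u /= hu.
have [/andP[u0 u1]|] := pselect (0 < u < 1); last by left.
right; apply: contrapT => nN; apply: hu.
have {nN} notN (x : rat) : ~ N (ratr x) u.
  by move=> Nx; apply: nN; exists (pickle x) => //; rewrite /r pickleK.
apply/cvgrPdist_lt => e e0.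
(* Rationals x, y within e/2 of q u on either side. As u avoids their exceptional sets, there are s
   < u < s' with x <= q s and q s' <= y. Rationals a in (s, u) and b in (u, s') then trap the value
   at u. *)
have [x] := @rat_in_itvoo R (q u - e / 2) (q u) ltac:(lra).
have [y] := @rat_in_itvoo R (q u) (q u + e / 2) ltac:(lra).
rewrite !in_itv/= => /andP[y1 y2] /andP[x1 x2].
have [s [s0 su xs]] : exists s, [/\ 0 < s, s < u & ratr x <= q s].
  apply: contrapT => h; apply: (notN x); split => [|s s0 su|s us s1]; first by rewrite u0.
    by rewrite ltNge; apply/negP => ?; apply: h; exists s.
  by apply: (lt_le_trans x2); apply: mq => //; exact: ltW.
have [s' [us' s'1 ys']] : exists s, [/\ u < s, s < 1 & q s <= ratr y].
  apply: contrapT => h; apply: (notN y); split => [|t t0 tu|t ut t1]; first by rewrite u0.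
    by apply: (le_lt_trans _ y1); apply: mq => //; exact: ltW.
  by rewrite ltNge; apply/negP => ?; apply: h; exists t.
have [a] := rat_in_itvoo su; have [b] := rat_in_itvoo us'.
rewrite !in_itv/= => /andP[b1 b2] /andP[a1 a2].
have a01 : (0 < (ratr a : R) < 1) by rewrite (lt_trans s0 a1) (lt_trans a2 u1).
have b01 : (0 < (ratr b : R) < 1) by rewrite (lt_trans u0 b1) (lt_trans b2 s'1).
have e2 : 0 < e / 2 by lra.
have [/andP[a0 a3] /andP[b0 b3]] := (a01, b01).
near=> j; rewrite /=.
have h1 : `|q_ (phi j) (ratr a) - q (ratr a)| < e / 2 by near: j; exact: conv_rat.
have h2 : `|q_ (phi j) (ratr b) - q (ratr b)| < e / 2 by near: j; exact: conv_rat.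
have k1 : q s <= q (ratr a) by apply: mq => //; exact: ltW.
have k2 : q (ratr b) <= q s' by apply: mq => //; exact: ltW.
have k3 : q_ (phi j) (ratr a) <= q_ (phi j) u by apply: qm => //; exact: ltW.
have k4 : q_ (phi j) u <= q_ (phi j) (ratr b) by apply: qm => //; exact: ltW.
move: h1 h2; rewrite !ltr_norml => /andP[? ?] /andP[? ?]; apply/andP; split; lra.
Unshelve. all: by end_near. Qed.

End unif.

(** * Limits of laws under almost sure convergence *)

Section limit_laws.
Context d (T : measurableType d) (R : realType) (P : probability T R).

(** Fatou's lemma in the one-sided form h <= liminf h_j, which suits indicators of open sets: along
    a convergent sequence they need only be lower semicontinuous. *)
Lemma fatou_le (h_ : nat -> T -> R) (h : T -> R) (c_ : nat -> R) (c : R) :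
  (forall j, measurable_fun setT (h_ j)) -> measurable_fun setT h ->
  (forall j t, 0 <= h_ j t) -> (forall t, 0 <= h t) ->
  {ae P, forall t, forall e : R, 0 < e -> \forall j \near \oo, h t - e <= h_ j t} ->
  (forall j, \int[P]_t (h_ j t)%:E <= (c_ j)%:E)%E -> c_ @ \oo --> c ->
  (\int[P]_t (h t)%:E <= c%:E)%E.
Proof.
move=> mh_ mh h_0 h0 hle intc cc.
have mE j : measurable_fun setT (fun t => (h_ j t)%:E) by exact/measurable_EFinP.
have E0 j t : setT t -> (0 <= (h_ j t)%:E)%E by rewrite lee_fin.
apply: (@le_trans _ _ (\int[P]_t (limn_einf (fun j => (h_ j t)%:E)))%E).
  apply: ae_ge0_le_integral => //.
  - move=> t _; by rewrite lee_fin.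
  - exact/measurable_EFinP.
  - move=> t _; rewrite limn_einf_lim; apply: lime_ge; first exact: is_cvg_einfs.
    by apply: nearW => n; apply: le_ereal_inf_tmp => _ [k _ <-]; rewrite lee_fin.
  - under eq_fun do rewrite limn_einf_lim.
    apply: (emeasurable_fun_cvg (fun n t => einfs (fun j => (h_ j t)%:E) n)).
      by move=> n; exact: measurable_fun_einfs.
    by move=> t _; exact: is_cvg_einfs.
  - apply: filterS hle => t ht _; apply/lee_addgt0Pr => e e0.
    rewrite -leeBlDr// limn_einf_lim; apply: lime_ge; first exact: is_cvg_einfs.
    have [N _ hN] := ht e e0; exists N => // n /= Nn.
    apply: le_ereal_inf_tmp => _ [k /= nk <-]; rewrite -EFinB lee_fin.
    by apply: hN => /=; exact: leq_trans nk.
apply: (le_trans (@fatou _ _ _ P setT measurableT _ mE E0)).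
have cE : (fun j => (c_ j)%:E) @ \oo --> c%:E by apply/fine_cvgP; split; [exact: nearW|].
rewrite -(cvg_lim _ cE)// limn_einf_lim; apply: lee_lim.
- exact: is_cvg_einfs.
- by apply/cvg_ex; exists c%:E.
- apply: nearW => n; apply: (le_trans _ (intc n)); apply: ge_ereal_inf; by exists (\int[P]_t (h_ n t)%:E)%E => //; exists n => /=.
Qed.

Lemma bounded_cvg (f_ : nat -> T -> R) (f : T -> R) :
  (forall j, measurable_fun setT (f_ j)) -> measurable_fun setT f ->
  (forall j t, `|f_ j t| <= 1) ->
  {ae P, forall t, f_ ^~ t @ \oo --> f t} ->
  (\int[P]_t (f_ j t)%:E @[j --> \oo] --> \int[P]_t (f t)%:E)%E.
Proof.
move=> mf_ mf fb fc.
have [] := @dominated_convergence _ _ _ P setT measurableT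
  (fun j t => (f_ j t)%:E) (fun t => (f t)%:E) (cst 1%E).
- by move=> j; exact/measurable_EFinP.
- exact/measurable_EFinP.
- apply: filterS fc => t ft _; apply/fine_cvgP; split; first exact: nearW.
  exact: ft.
- exact: finite_measure_integrable_cst.
- by apply: nearW => t j _ /=; rewrite lee_fin.
- by move=> _ _.
Qed.

End limit_laws.

Section same_limit.
Context {R : realType}.

Lemma cdf_unique (mu nu : law R) : (forall x, mu `]-oo, x]%classic = nu `]-oo, x]%classic) ->
  forall A : set R, measurable A -> mu A = nu A.
Proof.
move=> mn.
apply: (measure_unique (@RGenOInfty.G R) (fun n => `]- n%:R, +oo[%classic)).
- exact: RGenOInfty.measurableE.
- move=> _ _ [x ->] [y ->]; exists (Num.max x y); apply/seteqP; split => z /=; rewrite !in_itv/= !andbT gt_max.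
    by move=> [-> ->].
  by move=> /andP[].
- by move=> n; exists (- n%:R).
- apply/seteqP; split => // x _; exists (Num.bound `|x|) => //=.
  have := archi_boundP (normr_ge0 x); rewrite ltr_norml => /andP[h _].
  by rewrite in_itv/= andbT.
- move=> _ [x ->].
  have E (P : law R) : P `]x, +oo[%classic = (1 - P `]-oo, x]%classic)%E.
    by rewrite -probability_setC// setCitvl.
  by apply: (etrans (E mu)); rewrite mn -E.
- by move=> n; rewrite (le_lt_trans (probability_le1 _ _)) ?ltry.
Qed.

(* A continuous function equal to 1 on ]-oo, x] and tending to 0 beyond x as n grows. *)
Let ramp (x : R) (n : nat) (t : R) := (1 + n%:R * (t - x + `|t - x|))^-1.

Let ramp_ge (x : R) n (t : R) : 1 <= 1 + n%:R * (t - x + `|t - x|).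
Proof.
rewrite lerDl mulr_ge0//; have := ler_norm (- (t - x)); rewrite normrN; lra.
Qed.

Let ramp_le1 (x : R) n (t : R) : `|ramp x n t| <= 1.
Proof.
have h := ramp_ge x n t; have h0 := lt_le_trans ltr01 h.
by rewrite /ramp ger0_norm ?invr_ge0 ?(ltW h0)// invf_le1.
Qed.

Let ramp_cvg (x : R) n (a : nat -> R) (l : R) : a @ \oo --> l -> ramp x n (a j) @[j --> \oo] --> ramp x n l.
Proof.
move=> al; have h0 := lt_le_trans ltr01 (ramp_ge x n l).
apply: cvgV; first by rewrite gt_eqF.
have alx : a j - x @[j --> \oo] --> l - x by apply: cvgB => //; exact: cvg_cst.
apply: cvgD; first exact: cvg_cst.
apply: cvgM; first exact: cvg_cst.
by apply: cvgD => //; exact: cvg_norm.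
Qed.

Let ramp_lim (x t : R) : ramp x n t @[n --> \oo] --> (\1_(`]-oo, x]%classic) t : R).
Proof.
rewrite indicE; have [tx|xt] := leP t x.
  rewrite mem_set/= ?in_itv//=; rewrite [X in X @ _ --> _](_ : _ = cst 1); first exact: cvg_cst.
  by apply/funext => n; rewrite /ramp ler0_norm ?subr_le0// subrr mulr0 addr0 invr1.
rewrite memNset/=; last by rewrite in_itv/= leNgt xt.
have tx0 : 0 < t - x by rewrite subr_gt0.
apply/cvgrPdist_lt => e e0; near=> n.
rewrite sub0r normrN /ramp (gtr0_norm tx0).
have h1 : 0 < 1 + n%:R * (t - x + (t - x)) by rewrite ltr_pwDl// mulr_ge0//; lra.
rewrite ger0_norm ?invr_ge0 ?ltW// invf_plt ?posrE//.
have : e^-1 / (t - x) < n%:R by near: n; exact: nbhs_infty_gtr.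
rewrite ltr_pdivrMr// => h; have n0 : 0 <= n%:R :> R by []. nra.
Unshelve. all: by end_near. Qed.

Let measurable_ramp (x : R) n d (T : measurableType d) (X : {mfun T >-> R}) :
  measurable_fun setT (fun t => ramp x n (X t)).
Proof.
have mr : measurable_fun setT (ramp x n).
  apply: continuous_measurable_fun => t.
  have h0 := lt_le_trans ltr01 (ramp_ge x n t).
  apply: cvgV; first by rewrite gt_eqF.
  have alx : s - x @[s --> t] --> t - x by apply: cvgB => //; exact: cvg_cst.
  apply: cvgD; first exact: cvg_cst.
  apply: cvgM; first exact: cvg_cst.
  by apply: cvgD => //; exact: cvg_norm.
by apply: measurableT_comp => //; exact: measurable_funPT.
Qed.

(** The integrals of each ramp agree for every j, hence in the limit by bounded convergence. Letting
    the ramps decrease to the indicator of a ray then identifies the distribution functions. *)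
Lemma eq_law_limit d (T : measurableType d) (P : probability T R)
    d' (T' : measurableType d') (P' : probability T' R)
    (X_ : nat -> {mfun T >-> R}) (X : {mfun T >-> R})
    (X'_ : nat -> {mfun T' >-> R}) (X' : {mfun T' >-> R}) :
  {ae P, forall t, X_ j t @[j --> \oo] --> X t} ->
  {ae P', forall t, X'_ j t @[j --> \oo] --> X' t} ->
  (forall j (A : set R), measurable A -> distribution P (X_ j) A = distribution P' (X'_ j) A) ->
  forall A : set R, measurable A -> distribution P X A = distribution P' X' A.
Proof.
move=> XX XX' eqX; apply: cdf_unique => x.
have rampE n : (\int[P]_t (ramp x n (X t))%:E = \int[P']_t (ramp x n (X' t))%:E)%E.
  have c1 : (\int[P]_t (ramp x n (X_ j t))%:E @[j --> \oo] --> \int[P]_t (ramp x n (X t))%:E)%E.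
    apply: bounded_cvg => //.
    by apply: filterS XX => t Xt; exact: ramp_cvg.
  have c2 : (\int[P']_t (ramp x n (X'_ j t))%:E @[j --> \oo] --> \int[P']_t (ramp x n (X' t))%:E)%E.
    apply: bounded_cvg => //.
    by apply: filterS XX' => t Xt; exact: ramp_cvg.
  have e j : (\int[P]_t (ramp x n (X_ j t))%:E = \int[P']_t (ramp x n (X'_ j t))%:E)%E.
    pose f (y : R) := (ramp x n y)%:E.
    have mf : measurable_fun setT f by apply/measurable_EFinP; exact: (measurable_ramp x n id_mfun).
    have f0 y : (0 <= f y)%E.
      by rewrite lee_fin invr_ge0 (le_trans ler01)// ramp_ge.
    rewrite -[LHS](@ge0_integral_distribution _ _ _ _ _ P (X_ j) f)//.
    rewrite -[RHS](@ge0_integral_distribution _ _ _ _ _ P' (X'_ j) f)//.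
    by apply: eq_measure_integral => A mA _; exact: eqX.
  move: c1; under eq_fun do rewrite e.
  by move=> c1; exact: (cvg_unique _ c1 c2).
have lim_ramp d0 (T0 : measurableType d0) (P0 : probability T0 R) (Z : {mfun T0 >-> R}) :
    (\int[P0]_t (ramp x n (Z t))%:E @[n --> \oo] --> distribution P0 Z `]-oo, x]%classic)%E.
  rewrite (_ : distribution P0 Z _ = \int[P0]_t (\1_(Z @^-1` `]-oo, x]%classic) t)%:E)%E; last first.
    by rewrite integral_indic ?setIT//; exact: measurable_funPTI.
  apply: bounded_cvg => //.
    by apply: measurable_indic; exact: measurable_funPTI.
  apply: nearW => t; have := @ramp_lim x (Z t).
  by rewrite !indicE (_ : (t \in Z @^-1` _) = (Z t \in `]-oo, x]%classic))//; apply/idP/idP; rewrite !inE.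
have := lim_ramp _ _ P X; under eq_fun do rewrite rampE.
by move=> /cvg_unique; apply => //; exact: lim_ramp.
Qed.

End same_limit.

(** * Quantile functions *)

Section quantiles.
Context {R : realType}.

Lemma unif_itv (a b : R) : 0 <= a -> a < b -> b <= 1 ->
  unif R `]a, b[%classic = (b - a)%:E.
Proof.
move=> a0 ab b1; apply: (etrans (unifE _)) => //.
rewrite (_ : _ `&` _ = `]a, b[%classic); last first.
  apply/seteqP; split => x /=; rewrite !in_itv/=; first by move=> [].
  by move=> /andP[ax xb]; rewrite ax xb !ltW// ?(le_lt_trans a0 ax)// (lt_le_trans xb b1).
by rewrite lebesgue_measure_itv/= lte_fin ab.
Qed.

(** If q u >= 0, then q^2 >= (q u)^2 on (u, 1), so (q u)^2 (1 - u) <= C; if q u < 0, the interval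
    (0, u) serves likewise. The bound depends on u and C only, hence is uniform along a sequence. *)
Lemma mono01_bound (q : {mfun measurableTypeR R >-> R}) (C : R) : mono01 q ->
  (\int[unif R]_u ((q u) ^+ 2)%:E <= C%:E)%E ->
  forall u : R, 0 < u < 1 -> `|q u| <= 1 + C / u + C / (1 - u).
Proof.
move=> qm qC u /andP[u0 u1].
have C0 : 0 <= C.
  by rewrite -lee_fin; apply: le_trans qC; apply: integral_ge0 => t _; rewrite lee_fin sqr_ge0.
have u1' : 0 < 1 - u by rewrite subr_gt0.
have key (a b : R) : 0 <= a -> a < b -> b <= 1 ->
    (forall v, a < v -> v < b -> q u ^+ 2 <= q v ^+ 2) -> q u ^+ 2 * (b - a) <= C.
  move=> a0 ab b1 h; rewrite -lee_fin; apply: le_trans qC.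
  have mI : measurable (`]a, b[%classic : set (measurableTypeR R)) by exact: measurable_itv.
  rewrite EFinM -unif_itv//.
  rewrite [X in (_ * X <= _)%E](_ : _ = \int[unif R]_t (\1_(`]a, b[%classic) t)%:E)%E; last first.
    by rewrite integral_indic// setIT.
  rewrite -ge0_integralZl//; last 2 first.
  - exact/measurable_EFinP.
  - by rewrite lee_fin sqr_ge0.
  apply: ge0_le_integral => //.
  - by move=> t _; rewrite -EFinM lee_fin mulr_ge0// sqr_ge0.
  - by apply/measurable_EFinP; apply: measurable_funM.
  - by apply/measurable_EFinP; apply: measurable_funX; exact: measurable_funPT.
  - move=> t _; rewrite -EFinM lee_fin indicE; case: (boolP (t \in _)) => [|_]; last by rewrite mulr0 sqr_ge0.
    by rewrite inE /= in_itv/= => /andP[? ?]; rewrite mulr1; exact: h.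
have Cu : 0 <= C / u by rewrite divr_ge0// ltW.
have Cu1 : 0 <= C / (1 - u) by rewrite divr_ge0// ltW.
have sq (x K : R) : x ^+ 2 <= K -> `|x| <= 1 + K.
  have := sqr_ge0 (`|x| - 1); rewrite -(real_normK (num_real x)); nra.
have [q0|q0] := leP 0 (q u).
  have : q u ^+ 2 * (1 - u) <= C.
    apply: key => //; first exact: ltW.
    move=> v uv v1; rewrite ler_sqr ?nnegrE//; first by apply: qm => //; exact: ltW.
    by apply: (le_trans q0); apply: qm => //; exact: ltW.
  rewrite -ler_pdivlMr// => /sq; lra.
have : q u ^+ 2 * (u - 0) <= C.
  apply: key => //; first exact: ltW.
  move=> v v0 vu; have qvu : q v <= q u by apply: qm => //; exact: ltW.
  rewrite -[leLHS]sqrrN -[leRHS]sqrrN ler_sqr ?nnegrE; lra.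
rewrite subr0 -ler_pdivlMr// => /sq; lra.
Qed.

(** The generalized inverse q u = inf {x | u <= F x} of the distribution function F, set to 0
    outside (0, 1). *)
Lemma quantile (mu : law R) : exists q : {mfun measurableTypeR R >-> R},
  mono01 q /\ forall A : set R, measurable A -> mu A = distribution (unif R) q A.
Proof.
pose F x := mu `]-oo, x]%classic.
have FE x : F x = cdf (lid mu) x by [].
have Fhomo : {homo F : x y / x <= y >-> (x <= y)%E}.
  by move=> x y xy; rewrite !FE; exact: cdf_nondecreasing.
pose S u := [set x | (u%:E <= F x)%E].
pose q u : R := if 0 < u < 1 then inf (S u) else 0.
have S_inf u : 0 < u < 1 -> has_inf (S u).
  move=> /andP[u0 u1]; split.
    apply: contrapT => h.
    have := @cvg_cdfy1 _ _ _ _ (lid mu) => /[dup] /(cvg_lim (@ereal_hausdorff R)) e c.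
    have : (1 <= u%:E)%E.
      rewrite -e; apply: lime_le; first by apply/cvg_ex; exists 1%E.
      by apply: nearW => x; rewrite leNgt; apply/negP => hx; apply: h; exists x; exact: ltW.
    by rewrite lee_fin leNgt u1.
  have [x hx] : exists x, (F x < u%:E)%E.
    apply: contrapT => h.
    have := @cvg_cdfNy0 _ _ _ _ (lid mu) => /[dup] /(cvg_lim (@ereal_hausdorff R)) e c.
    have : (u%:E <= 0)%E.
      rewrite -e; apply: lime_ge; first by apply/cvg_ex; exists 0%E.
      by apply: nearW => x; rewrite leNgt; apply/negP => hx; apply: h; exists x.
    by rewrite lee_fin leNgt u0.
  exists x => y; rewrite /S/= => hy; rewrite leNgt; apply/negP => yx.
  by have := le_lt_trans (le_trans hy (Fhomo _ _ (ltW yx))) hx; rewrite ltxx.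
(* The Galois connection between q and F. Its forward direction rests on u <= F (q u), that is, on
   the right continuity of F. *)
have qP u x : 0 < u < 1 -> (q u <= x) = (u%:E <= F x)%E.
  move=> u01; have hS := S_inf _ u01; apply/idP/idP; last first.
    by move=> h; rewrite /q u01; apply: ge_inf => //; exact: hS.2.
  move=> qx; apply: (@le_trans _ _ (F (q u))); last exact: Fhomo.
  rewrite FE.
  have rc := @cdf_right_continuous _ _ _ _ (lid mu) (q u).
  rewrite -(cvg_lim _ rc)//; apply: lime_ge; first by apply/cvg_ex; eexists; exact: rc.
  near=> y; rewrite -FE.
  have qy : inf (S u) < y by rewrite (_ : inf _ = q u)//; by rewrite /q u01.
  have e0 : 0 < y - inf (S u) by rewrite subr_gt0.
  have [z Sz zy] := inf_adherent e0 hS.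
  apply: (le_trans Sz); apply: Fhomo; rewrite ltW//; move: zy; lra.
have mq : mono01 q.
  move=> u v u0 uv v1.
  have v01 : 0 < v < 1 by rewrite v1 (lt_le_trans u0 uv).
  rewrite qP ?u0 ?(le_lt_trans uv v1)//.
  by apply: (@le_trans _ _ v%:E); rewrite ?lee_fin// -qP.
have mQ : measurable_fun (setT : set (measurableTypeR R)) q.
  by apply: measurable_mono01 => // u; rewrite /q => /negP/negbTE->.
exists (mfun_of mQ); split => //; apply: cdf_unique => x.
have Fx : mu `]-oo, x]%classic = (fine (F x))%:E by rewrite fineK// fin_num_measure.
rewrite Fx -unif_ray; last first.
  by rewrite -!lee_fin -Fx measure_ge0 probability_le1.
have mA : measurable (q @^-1` `]-oo, x]%classic : set (measurableTypeR R)).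
  by rewrite -[X in measurable X]setTI; exact: mQ.
rewrite /distribution /pushforward /=.
rewrite -[LHS]fineK ?fin_num_measure// -[RHS]fineK ?fin_num_measure//; congr EFin.
(* Inclusions need only be checked on (0, 1), which has full uniform measure. *)
have aeE (B C : set (measurableTypeR R)) : measurable B -> measurable C ->
    (forall u : R, 0 < u < 1 -> B u -> C u) -> (unif R B <= unif R C)%E.
  move=> mB mC BC; have mI : measurable (`]0, 1[%classic : set (measurableTypeR R)) by exact: measurable_itv.
  have I1 : unif R (`]0, 1[%classic) = 1%E by rewrite unif_itv// subr0.
  have Ic : unif R (~` `]0, 1[%classic) = 0%E by rewrite probability_setC// [X in (_ - X)%E]I1 subee.
  apply: (@le_trans _ _ (unif R (C `|` ~` `]0, 1[%classic))).
    apply: le_measure; rewrite ?inE//; first by apply: measurableU => //; exact: measurableC.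
    move=> u Bu; have [u01|u01] := boolP (0 < u < 1); first by left; exact: BC.
    by right; rewrite /= in_itv/=; exact/negP.
  apply: (le_trans (measureU2 (unif R) mC (measurableC mI))).
  by rewrite [X in (_ + X)%E]Ic adde0.
congr fine; apply/eqP; rewrite eq_le; apply/andP; split; apply: aeE => //.
- by move=> u u01 /=; rewrite !in_itv/= qP// => h; rewrite -(@fineK _ (F x)) ?fin_num_measure.
- by move=> u u01 /=; rewrite !in_itv/= qP// -(@fineK _ (F x)) ?fin_num_measure.
Unshelve. all: by end_near. Qed.

End quantiles.

(** * Almost sure limits of infinitely divisible quantile functions *)

Section id_limit.
Context {R : realType}.

Let measurable_real (f : {mfun measurableTypeR R >-> R}) : measurable_fun (setT : set R) (f : R -> R).
Proof. by move=> _ A mA; exact: (@measurable_funPT _ _ _ _ f measurableT A mA). Qed.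

(** The uniform law transported by the identity from [measurableTypeR R] to R, where [exists_iid]
    expects it. *)
Let unif_law : law R := distribution (unif R)
  (@mfun_of _ _ (measurableTypeR R) R (fun x => x) (@measurable_id _ R setT)).

Lemma id_law_limit (q_ : nat -> {mfun measurableTypeR R >-> R})
    (q : {mfun measurableTypeR R >-> R}) (C : R) :
  (forall k, id_law (distribution (unif R) (q_ k))) ->
  (forall k, \int[unif R]_u ((q_ k u) ^+ 2)%:E <= C%:E)%E ->
  {ae unif R, forall u : R, q_ j u @[j --> \oo] --> (q u : R)} ->
  id_law (distribution (unif R) q).
Proof.
move=> idq qC qcvg n.
have /choice[nu nuP] : forall k, exists nu : law R, forall A : set R, measurable A ->
    distribution (unif R) (q_ k) A = convpow nu n.+1 A by move=> k; exact: idq.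
(* The roots inherit the bound C: the second moment of the power is (n+1) times that of the root
   plus a nonnegative term. *)
have nuC k : (\int[nu k]_x (x ^+ 2)%:E <= C%:E)%E.
  have lawC : (\int[distribution (unif R) (q_ k)]_x (x ^+ 2)%:E <= C%:E)%E.
    rewrite ge0_integral_distribution//; first exact: qC.
      by apply/measurable_EFinP; exact: measurable_funX.
    by move=> y; rewrite lee_fin sqr_ge0.
  have [h2 e2 e1] := eq_law_moments (nuP k).
  have q2 : finite_second_moment (lid (distribution (unif R) (q_ k))).
    by apply/finite_second_momentP; apply: (le_lt_trans lawC); rewrite ltry.
  have [nu2 _ E2] := moments_convpow (h2 q2).
  have m2E : (\int[nu k]_x (x ^+ 2)%:E = (m2 (lid (nu k)))%:E)%E.
    by rewrite /m2 fineK//; exact: integrable_fin_num nu2.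
  have m2E' : (\int[distribution (unif R) (q_ k)]_x (x ^+ 2)%:E = (m2 (lid (distribution (unif R) (q_ k))))%:E)%E.
    by rewrite /m2 fineK//; exact: integrable_fin_num q2.
  rewrite m2E lee_fin; move: lawC; rewrite m2E' lee_fin e2 E2.
  have m0 : 0 <= m2 (lid (nu k)) by rewrite -lee_fin -m2E; apply: integral_ge0 => x _; rewrite lee_fin sqr_ge0.
  have := sqr_ge0 (mean (lid (nu k))); rewrite -natr1.
  have n0 : 0 <= n%:R :> R by []. have n1 : 0 <= (n.+1 * n)%:R :> R by [].
  move=> h; nra.
have /choice[r_ rP] : forall k, exists r : {mfun measurableTypeR R >-> R},
    mono01 r /\ forall A : set R, measurable A -> nu k A = distribution (unif R) r A.
  by move=> k; exact: quantile.
have rC k : (\int[unif R]_u ((r_ k u) ^+ 2)%:E <= C%:E)%E.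
  apply: le_trans (nuC k).
  rewrite [leRHS](eq_measure_integral (distribution (unif R) (r_ k))); last first.
    by move=> A mA _; exact: (rP k).2.
  rewrite ge0_integral_distribution//.
    by apply/measurable_EFinP; exact: measurable_funX.
  by move=> y; rewrite lee_fin sqr_ge0.
have rB (u : R) : 0 < u < 1 -> exists B : R, forall k, `|r_ k u| <= B.
  by move=> u01; exists (1 + C / u + C / (1 - u)) => k; apply: (mono01_bound (rP k).1 (rC k)).
have [phi [r [phij rm rcvg]]] := @helly R (fun k => r_ k) (fun k => (rP k).1) rB.
(* Fixing the uniform variables once lets almost everywhere convergence of the quantile functions
   become almost sure convergence of the sums. *)
have [d [T [Q [U [indU lawU]]]]] := exists_iid unif_law n.+1.
have mZi (f : {mfun measurableTypeR R >-> R}) i : measurable_fun setT ((f : R -> R) \o U i).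
  by apply: measurableT_comp; [exact: measurable_real|exact: measurable_funPT].
pose Zi (f : {mfun measurableTypeR R >-> R}) i : {RV Q >-> R} := mfun_of (mZi f i).
have mZ (f : {mfun measurableTypeR R >-> R}) : measurable_fun setT (fun t => \sum_(i < n.+1) Zi f i t).
  by apply: measurable_sum => i; exact: measurable_funPT.
pose Z f : {mfun T >-> R} := mfun_of (mZ f).
have lawZ (f : {mfun measurableTypeR R >-> R}) (A : set R) : measurable A ->
    distribution Q (Z f) A = convpow (distribution (unif R) f) n.+1 A.
  move=> mA; apply: (@law_sum_iid _ _ _ Q n.+1 (Zi f)) => //.
    move=> B mB; have := indU (fun i => (f : R -> R) @^-1` B i).
    apply => i; rewrite -[X in measurable X]setTI; exact: measurable_real.
  move=> i B mB.
  apply: (lawU i ((f : R -> R) @^-1` B)).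
  rewrite -[X in measurable X]setTI; exact: measurable_real.
exists (distribution (unif R) r) => A mA; rewrite -lawZ//; apply/esym.
apply: (@eq_law_limit _ _ _ Q _ _ (unif R) (fun j => Z (r_ (phi j))) (Z r)
  (fun j => q_ (phi j)) q) => //.
- have h (i : 'I_n.+1) : {ae Q, forall t, r_ (phi j) (U i t) @[j --> \oo] --> r (U i t)}.
    (* Since [U i] is uniform, it pulls the exceptional null set back to a null set. *)
    case: rcvg => M [mM M0 subM]; exists (U i @^-1` M); split.
    + exact: measurable_funPTI.
    + by apply: (etrans (lawU i M mM)).
    + by move=> t /= ht; exact: subM.
  have hall : {ae Q, forall t, forall i, r_ (phi j) (U i t) @[j --> \oo] --> r (U i t)} by exact: filter_forall.
  apply: filterS hall => t ht /=.
  by apply: cvg_big => [|i _]; [exact: add_continuous|exact: ht].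
- apply: (negligibleS _ qcvg) => u /= hn hu; apply: hn.
  apply: (@cvg_comp _ _ _ phi (fun j => q_ j u) _ _ _ _ hu).
  by apply/cvgnyPge => m; exists m => // j /= mj; exact: leq_trans (phij j).
- move=> j B mB; rewrite lawZ// nuP//; apply: eq_convpow => // D mD.
  by apply/esym; exact: (rP (phi j)).2.
Qed.

End id_limit.

(** * The Poisson law *)

Section poisson.
Context {R : realType}.

Lemma eq_measure_nat (m1 m2 : {measure set nat -> \bar R}) :
  (forall k, m1 [set k] = m2 [set k]) -> forall A, m1 A = m2 A.
Proof.
move=> m12 A.
have E (m : {measure set nat -> \bar R}) : m A = (\sum_(k <oo | k \in A) m [set k])%E.
  rewrite -measure_bigcup//; first by rewrite bigcup_imset1 image_id.
  by move=> i j _ _ [k [/= -> ->]].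
by rewrite !E; apply: eq_eseriesr => k _.
Qed.

Lemma poisson_set1 (a : R) k : 0 < a ->
  poisson_prob a 0 [set k] = (a ^+ k * k`!%:R^-1 * expR (- a))%:E.
Proof.
move=> a0; rewrite /poisson_prob a0 esum_set1 ?lee_fin ?poisson_pmf_ge0//.
by rewrite /poisson_pmf a0.
Qed.

Definition natr : {mfun nat >-> R} :=
  @mfun_of _ _ nat R (fun n => n%:R) (fun _ _ _ => I).

Definition poisson_law (a : R) : law R := distribution (poisson_prob a 0) natr.

(** The mass of the sum at k splits over the pairs (i, k - i), and the binomial theorem adds up the
    products. *)
Lemma convolve_poisson (a b : R) : 0 < a -> 0 < b ->
  forall A : set R, measurable A ->
  convolve (poisson_law a) (poisson_law b) A = poisson_law (a + b) A.
Proof.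
move=> a0 b0 A mA.
pose Q := (poisson_prob a 0 \x poisson_prob b 0)%E.
have m1 : measurable_fun setT ((natr : nat -> R) \o (fst : nat * nat -> nat)).
  by apply: measurableT_comp; [exact: measurable_funPT|exact: measurable_fst].
have m2 : measurable_fun setT ((natr : nat -> R) \o (snd : nat * nat -> nat)).
  by apply: measurableT_comp; [exact: measurable_funPT|exact: measurable_snd].
have m3 : measurable_fun setT (fun z : nat * nat => (z.1 + z.2)%N).
  by apply: measurable_fun_addn; [exact: measurable_fst|exact: measurable_snd].
rewrite -(@convolve_joint0 _ _ _ Q (mfun_of m1) (mfun_of m2))//; last first.
  move=> B C mB mC; rewrite (_ : _ `&` _ = ((natr : nat -> R) @^-1` B) `*` ((natr : nat -> R) @^-1` C)); last first.
    by apply/seteqP; split => z.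
  exact: (@product_measure1E _ _ _ _ _ (poisson_prob a 0) (poisson_prob b 0)).
pose S : {mfun (nat * nat)%type >-> nat} := mfun_of m3.
transitivity (distribution Q S ((natr : nat -> R) @^-1` A)).
  rewrite /distribution /pushforward /=; congr (Q _).
  by apply/seteqP; split => z /=; rewrite natrD.
apply: eq_measure_nat => k.
rewrite /= [RHS]poisson_set1 ?addr_gt0//.
pose F i : set (nat * nat) := [set i] `*` [set (k - i)%N].
rewrite /distribution /pushforward (_ : _ @^-1` _ = \big[setU/set0]_(i < k.+1) F i); last first.
  rewrite -bigcup_mkord; apply/seteqP; split => [[i j] /= ij|[i j] [l /= lk [/= -> ->]]].
    exists i; first by rewrite /= ltnS -ij leq_addr.
    by split => //=; rewrite -ij; apply/esym/addKn.
  by apply: subnKC; rewrite -ltnS.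
have mF i : measurable (F i) by exact: measurableX.
have tF : trivIset setT F by move=> i j _ _ [[x y] [[/= <- _] [/= <- _]]].
rewrite [LHS](measure_bigsetU Q mF tF).
have QF i : Q (F i) = (a ^+ i / i`!%:R * expR (- a) *
    (b ^+ (k - i) / (k - i)`!%:R * expR (- b)))%:E.
  rewrite EFinM -!poisson_set1//.
  exact: (@product_measure1E _ _ _ _ _ (poisson_prob a 0) (poisson_prob b 0)).
transitivity (\sum_(i < k.+1) (a ^+ i / i`!%:R * expR (- a) *
    (b ^+ (k - i) / (k - i)`!%:R * expR (- b)))%:E)%E; first by apply: eq_bigr => i _; exact: QF.
rewrite sumEFin; congr EFin.
rewrite addrC exprDn !mulr_suml; apply: eq_bigr => i _.
rewrite opprD expRD -mulr_natl.
have ik : (i <= k)%N by rewrite -ltnS.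
have := bin_fact ik => /(congr1 (fun n => n%:R : R)); rewrite !natrM => e.
have f0 n : n`!%:R != 0 :> R by rewrite pnatr_eq0 -lt0n fact_gt0.
have f1 := f0 i; have f2 := f0 (k - i)%N; have f3 := f0 k.
rewrite -e; field.
rewrite f1 f2 /=.
by apply: contra f3 => /eqP b0'; rewrite -e b0' mul0r.
Qed.

Lemma id_law_poisson (a : R) : 0 < a -> id_law (poisson_law a).
Proof.
move=> a0 n; have [b b0 ->] : exists2 b, 0 < b & a = n.+1%:R * b.
  by exists (a / n.+1%:R); [rewrite divr_gt0|rewrite mulrC divfK].
exists (poisson_law b) => A mA.
elim: n => [|n IH] in A mA *; first by rewrite mul1r [RHS]convolve_dirac0.
rewrite [convpow _ _]/(convolve (convpow (poisson_law b) n.+1) (poisson_law b)).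
transitivity (convolve (poisson_law (n.+1%:R * b)) (poisson_law b) A).
  rewrite convolve_poisson// ?mulr_gt0//; congr (poisson_law _ A).
  by rewrite -[in LHS]natr1; ring.
by apply: eq_convolve.
Qed.

Lemma poisson_second_moment : finite_second_moment (lid (poisson_law 1)).
Proof.
apply/finite_second_momentP => /=.
rewrite ge0_integral_distribution//; last 2 first.
- by apply/measurable_EFinP; exact: measurable_funX.
- by move=> y; rewrite lee_fin sqr_ge0.
have E (m : {measure set nat -> \bar R}) (f : nat -> \bar R) : (forall k, 0 <= f k)%E ->
    (\int[m]_k f k = \sum_(k <oo) (f k * m [set k]))%E.
  move=> f0; rewrite (_ : setT = \bigcup_k [set k]); last first.
    by apply/seteqP; split => // k _; exists k.
  rewrite ge0_integral_bigcup//.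
  - apply: eq_eseriesr => k _; rewrite (eq_integral (fun=> f k)) ?integral_cst//.
    by move=> x; rewrite inE => ->.
  - by move=> i j _ _ [k [/= -> ->]].
rewrite E; last by move=> k; rewrite /= lee_fin sqr_ge0.
(* As k^2 <= 4^k, the k-th term is at most e^3 times the mass at k of the Poisson law of parameter
   4, and these masses sum to 1. *)
apply: (@le_lt_trans _ _ (\sum_(k <oo) ((expR 3)%:E * poisson_prob 4 0 [set k]))%E); last first.
  by rewrite -(E (poisson_prob 4 0) (fun=> (expR 3)%:E)) ?integral_cst//= ?probability_setT ?mule1 ?ltry// => k; rewrite lee_fin expR_ge0.
apply: lee_nneseries => [k _|k _]; first by rewrite mule_ge0//= lee_fin sqr_ge0.
rewrite /= !poisson_set1// -!EFinM lee_fin expr1n mul1r.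
have f0 : 0 <= k`!%:R^-1 :> R by rewrite invr_ge0.
have -> : expR 3 * (4 ^+ k / k`!%:R * expR (- 4)) = 4 ^+ k * (k`!%:R^-1 * expR (- 1)) :> R.
  have -> : (-1 : R) = 3 + (- 4) by ring.
  by rewrite (expRD 3 (- 4)); move: (4 ^+ k) (k`!%:R^-1) => p f; ring.
apply: ler_wpM2r; first by rewrite mulr_ge0// expR_ge0.
have -> : (4 : R) = 2 ^+ 2 by ring.
rewrite -exprM mulnC exprM ler_sqr ?nnegrE//.
by rewrite -natrX ler_nat ltnW// ltn_expl.
Qed.

(** This member makes both sets of values nonempty and, through [PI0_prob_lt1], puts m below 1. Its
    variance is positive because both 0 and 1 are charged. *)
Lemma poisson_in_I0 : in_I0 (lid (poisson_law 1)).
Proof.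
split; last split.
- apply/infinitely_divisibleP => n; exact: id_law_poisson.
- exact: poisson_second_moment.
rewrite lt_neqAle var_ge0 ?andbT; last exact: poisson_second_moment.
apply/eqP => /esym/(var0_dev poisson_second_moment).
set m := mean _ => h.
have mD : measurable [set t : R | `|t - m| <= 0].
  exact: (measurable_dev_le (lid (poisson_law 1)) 0).
have h0 : poisson_law 1 (~` [set t : R | `|t - m| <= 0]) = 0%E.
  by rewrite probability_setC// [X in (_ - X)%E]h subee.
have key (k : nat) : (k%:R : R) = m.
  apply/eqP; rewrite -subr_eq0 -normr_le0; apply/negPn/negP => km.
  have : (poisson_prob 1 0 [set k] <= poisson_law 1 (~` [set t : R | (`|t - m| <= 0)%R]))%E.
    by apply: le_measure; rewrite ?inE// => j /= ->; exact/negP.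
  by rewrite [X in (_ <= X)%E]h0 poisson_set1// lee_fin leNgt expr1n mul1r mulr_gt0 ?expR_gt0//.
have := key 0%N; rewrite -(key 1%N) => /eqP; by rewrite eq_sym oner_eq0.
Qed.

End poisson.

(** * Normalization and attainment of the infimum *)

Section law_of_variable.
Context d (T : measurableType d) (R : realType) (P : probability T R) (X : {RV P >-> R}).

Lemma m2_distribution : m2 (lid (distribution P X)) = m2 X.
Proof.
rewrite /m2 ge0_integral_distribution//.
  by apply/measurable_EFinP; exact: measurable_funX.
by move=> y; rewrite lee_fin sqr_ge0.
Qed.

Lemma finite_second_moment_distribution :
  finite_second_moment (lid (distribution P X)) <-> finite_second_moment X.
Proof.
rewrite !finite_second_momentP ge0_integral_distribution//.
  by apply/measurable_EFinP; exact: measurable_funX.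
by move=> y; rewrite lee_fin sqr_ge0.
Qed.

Lemma mean_distribution : finite_second_moment X -> mean (lid (distribution P X)) = mean X.
Proof.
move=> X2; rewrite /mean unlock (@integral_distribution _ _ _ _ _ _ X (fun y => y%:E))//.
  exact/measurable_EFinP.
exact: integrable_fst_moment X2.
Qed.

Lemma m2_ge0 : 0 <= m2 X.
Proof. by apply: fine_ge0; apply: integral_ge0 => t _; rewrite lee_fin sqr_ge0. Qed.

Lemma EFin_m2 : finite_second_moment X -> (\int[P]_t (X t ^+ 2)%:E = (m2 X)%:E)%E.
Proof. by move=> X2; rewrite fineK//; exact: integrable_fin_num X2. Qed.

Variables (Z : {RV P >-> R}) (a b : R).
Hypothesis ZE : forall t, Z t = a * X t + b.

Lemma infinitely_divisible_affine : infinitely_divisible X -> infinitely_divisible Z.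
Proof.
move=> idX n n1; have [d' [T' [Q [Y [indY [eqY sumY]]]]]] := idX n n1.
(* The shift b is shared equally among the n summands. *)
pose g (x : R) := a * x + b / n%:R.
have mg : measurable_fun setT g by apply: measurable_funD => //; exact: measurable_funM.
have mgB (B : set R) : measurable B -> measurable (g @^-1` B).
  by move=> mB; rewrite -[X in measurable X]setTI; exact: mg.
have mW i : measurable_fun setT (g \o Y i) by apply: measurableT_comp => //; exact: measurable_funPT.
exists d', T', Q, (fun i => mfun_of (mW i)); split; last split.
- move=> B mB; have := indY (fun i => g @^-1` B i); apply => i; exact: mgB.
- by move=> i j A mA; have := eqY i j (g @^-1` A); apply; exact: mgB.
- move=> A mA.
  pose f (x : R) := a * x + b.
  have mf : measurable_fun setT f by apply: measurable_funD => //; exact: measurable_funM.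
  have mfA : measurable (f @^-1` A) by rewrite -[X in measurable X]setTI; exact: mf.
  have := sumY _ mfA; congr (_ = _).
    have sumE t : \sum_(i < n) (a * Y i t + b / n%:R) = a * (\sum_(i < n) Y i t) + b.
      rewrite big_split/= -mulr_sumr sumr_const card_ord -[X in _ + X]mulr_natr divfK//.
      by rewrite pnatr_eq0 -lt0n.
    by congr (Q _); apply/seteqP; split => t /=; rewrite /f /g sumE.
  by congr (P _); apply/seteqP; split => t /=; rewrite ZE.
Qed.

Hypothesis X2 : finite_second_moment X.

Lemma moments_affine : [/\ finite_second_moment Z, mean Z = a * mean X + b &
  m2 Z = a ^+ 2 * m2 X + 2 * a * b * mean X + b ^+ 2].
Proof.
have E2 : (\int[P]_t (Z t ^+ 2)%:E = (a ^+ 2 * m2 X + 2 * a * b * mean X + b ^+ 2)%:E)%E.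
  rewrite -integral_quad//; apply: eq_integral => t _; rewrite ZE; congr EFin; ring.
split.
- by apply/finite_second_momentP; rewrite E2 ltry.
- rewrite {1}/mean unlock.
  have -> : (\int[P]_t (Z t)%:E = (0 * m2 X + a * mean X + b)%:E)%E.
    rewrite -integral_quad//; apply: eq_integral => t _; rewrite ZE; congr EFin; ring.
  by rewrite /= mul0r add0r.
- by rewrite {1}/m2 E2.
Qed.

End law_of_variable.

(** * Comparison of the infima and existence of a minimizer *)

Section main.
Context {R : realType}.

(** The law of (X - E X) / s, with s the standard deviation, turns the window |X - E X| < s into
    (-1, 1) and removes the dependence on the underlying space. *)
Lemma normalize d (T : measurableType d) (P : probability T R) (X : {RV P >-> R}) :
  in_I0 X -> exists mu : law R, [/\ id_law mu, finite_second_moment (lid mu),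
    mean (lid mu) = 0, m2 (lid mu) = 1 & PI0_prob X = fine (mu `]-1, 1[%classic)].
Proof.
move=> [idX [X2 v0]]; set s := Num.sqrt (var X).
have s0 : 0 < s by rewrite sqrtr_gt0.
have mZ : measurable_fun setT (fun t => s^-1 * X t + - (s^-1 * mean X)).
  by apply: measurable_funD => //; apply: measurable_funM => //; exact: measurable_funPT.
pose Z : {RV P >-> R} := mfun_of mZ.
have ZE t : Z t = s^-1 * X t + - (s^-1 * mean X) by [].
have [Z2 Z0 Z1] := moments_affine ZE X2.
exists (distribution P Z); split.
- by apply/infinitely_divisibleP; exact: infinitely_divisible_affine ZE idX.
- exact/finite_second_moment_distribution.
- by rewrite mean_distribution// Z0 subrr.
- rewrite m2_distribution Z1.
  have vE : s ^+ 2 = m2 X - mean X ^+ 2 by rewrite -varE// sqr_sqrtr// ltW.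
  have -> : s^-1 ^+ 2 * m2 X + 2 * s^-1 * - (s^-1 * mean X) * mean X + (- (s^-1 * mean X)) ^+ 2 =
    s^-1 ^+ 2 * (m2 X - mean X ^+ 2) by ring.
  by rewrite -vE -exprMn mulVf ?expr1n// gt_eqF.
- rewrite /PI0_prob -/s /distribution /pushforward; congr (fine (P _)).
  apply/seteqP; split => t /=; rewrite in_itv/= -ltr_norml -mulrBr normrM gtr0_norm ?invr_gt0//;
    by rewrite ltr_pdivrMl// mulr1.
Qed.

Lemma PI0_values_ge p : PI0_values R p -> 64^-1 <= p.
Proof.
move=> [d [T [P [X [X0 ->]]]]]; have [mu [idmu mu2 mu0 mu1 ->]] := normalize X0.
exact: normalized_id_ge.
Qed.

Lemma has_inf_PI0 : has_inf (PI0_values R).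
Proof.
split; last by exists 64^-1 => p; exact: PI0_values_ge.
by eexists; exists _, R, (poisson_law 1), (lid (poisson_law 1)); split; [exact: poisson_in_I0|reflexivity].
Qed.

Lemma inf_PI0_lt1 : inf (PI0_values R) < 1.
Proof.
have Y0 := @poisson_in_I0 R; have [_ [Y2 v0]] := Y0.
apply: le_lt_trans (PI0_prob_lt1 Y2 v0); apply: ge_inf; first exact: has_inf_PI0.2.
by exists _, R, (poisson_law 1), (lid (poisson_law 1)).
Qed.

(** For positive variance the closed window contains the open one. For zero variance the closed
    window has probability 1, which is above m because m < 1. *)
Lemma inf_PI0_le_inf_PI : inf (PI0_values R) <= inf (PI_values R).
Proof.
apply: lb_le_inf.
  have [idY [Y2 v0]] := @poisson_in_I0 R.
  by eexists; exists _, R, (poisson_law 1), (lid (poisson_law 1)); split; [|split; [|reflexivity]].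
move=> _ [d [T [P [X [idX [X2 ->]]]]]].
have [v0|v0] := ltP 0 (var X).
  apply: (@le_trans _ _ (PI0_prob X)).
    by apply: ge_inf; [exact: has_inf_PI0.2|exists d, T, P, X].
  apply: fine_le; rewrite ?fin_num_measure//; [exact: measurable_dev_lt|exact: measurable_dev_le|].
  apply: le_measure; rewrite ?inE//; [exact: measurable_dev_lt|exact: measurable_dev_le|].
  by move=> t /=; exact: ltW.
have v0' : var X = 0 by apply/eqP; rewrite eq_le v0 var_ge0.
by rewrite v0' sqrtr0 var0_dev//; exact: ltW inf_PI0_lt1.
Qed.

Let near_ge (a : nat -> R) (l : R) : a @ \oo --> l ->
  forall e : R, 0 < e -> \forall j \near \oo, l - e <= a j.
Proof.
move=> /cvgrPdist_le al e e0; near=> j.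
have : `|l - a j| <= e by near: j; exact: al.
by rewrite ler_norml => /andP[_]; lra.
Unshelve. all: by end_near. Qed.

Lemma inf_PI0_attained : exists q : {RV unif R >-> R},
  in_I0 q /\ inf (PI0_values R) = PI0_prob q.
Proof.
set m := inf _.
have /choice[mu muP] : forall k, exists mu : law R, [/\ id_law mu, finite_second_moment (lid mu),
    mean (lid mu) = 0, m2 (lid mu) = 1 & fine (mu `]-1, 1[%classic) <= m + k.+1%:R^-1].
  move=> k; have k0 : 0 < k.+1%:R^-1 :> R by rewrite invr_gt0.
  have [p [d [T [P [X [X0 pE]]]]] pm] := inf_adherent k0 has_inf_PI0.
  have [mu [h1 h2 h3 h4 h5]] := normalize X0.
  by exists mu; split => //; rewrite -h5 -pE ltW.
have /choice[q_ qP] : forall k, exists q : {mfun measurableTypeR R >-> R},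
    mono01 q /\ forall A : set R, measurable A -> mu k A = distribution (unif R) q A.
  by move=> k; exact: quantile.
have mom k : [/\ finite_second_moment (q_ k : {RV unif R >-> R}),
    mean (q_ k : {RV unif R >-> R}) = 0 & m2 (q_ k : {RV unif R >-> R}) = 1].
  have [_ mu2 mu0 mu1 _] := muP k; have [h2 e2 e1] := eq_law_moments (qP k).2.
  have q2 : finite_second_moment (q_ k : {RV unif R >-> R}).
    by apply/finite_second_moment_distribution; exact: h2.
  by split => //; [rewrite -mean_distribution// -e1|rewrite -m2_distribution -e2].
have qC k : (\int[unif R]_u ((q_ k u) ^+ 2)%:E <= 1%:E)%E.
  by have [h _ h1] := mom k; rewrite EFin_m2// h1.
have qB (u : R) : 0 < u < 1 -> exists B : R, forall k, `|q_ k u| <= B.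
  by move=> u01; exists (1 + 1 / u + 1 / (1 - u)) => k; apply: (mono01_bound (qP k).1 (qC k)).
have [phi [q [phij qm qcvg]]] := @helly R (fun k => q_ k) (fun k => (qP k).1) qB.
have idq : id_law (distribution (unif R) q).
  apply: (@id_law_limit R (fun j => q_ (phi j)) q 1) => // k n.
  have [/(_ n)[nu nuE] _ _ _ _] := muP (phi k); exists nu => A mA.
  by rewrite -nuE// (qP (phi k)).2.
pose Y : {RV unif R >-> R} := q.
have mY : measurable_fun setT Y by exact: measurable_funPT.
have mq j : measurable_fun setT (q_ (phi j)) by exact: measurable_funPT.
(* Along the sequence the mean is 0 and the second moment is 1, so the quadratic integrates to a +
   c; nonnegativity allows Fatou. *)
have fatou_quad (a b c : R) : (forall x : R, 0 <= a * x ^+ 2 + b * x + c) ->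
    (\int[unif R]_u (a * Y u ^+ 2 + b * Y u + c)%:E <= (a + c)%:E)%E.
  move=> h0.
  apply: (@fatou_le _ _ R (unif R) (fun j u => a * q_ (phi j) u ^+ 2 + b * q_ (phi j) u + c)
    _ (fun=> a + c)) => //.
  - move=> j; apply: measurable_funD => //; apply: measurable_funD; apply: measurable_funM => //.
    exact: measurable_funX.
  - apply: measurable_funD => //; apply: measurable_funD; apply: measurable_funM => //.
    exact: measurable_funX.
  - apply: (negligibleS _ qcvg) => u /= hn hu; apply: hn; apply: near_ge.
    apply: cvgD; last exact: cvg_cst.
    apply: cvgD; apply: cvgM; [exact: cvg_cst| |exact: cvg_cst|exact: hu].
    by rewrite expr2; under eq_fun do rewrite expr2; exact: cvgM.
  - by move=> j; have [h2 e1 e2] := mom (phi j); rewrite integral_quad// e1 e2 mulr1 mulr0 addr0.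
  - exact: cvg_cst.
have Y2 : finite_second_moment Y.
  apply/finite_second_momentP.
  have := fatou_quad 1 0 0; under eq_integral do rewrite mul1r mul0r !addr0.
  by move=> h; apply: (le_lt_trans (h _)); rewrite ?ltry// => x; rewrite mul1r mul0r !addr0 sqr_ge0.
have m2Y : m2 Y <= 1.
  have := fatou_quad 1 0 0; rewrite integral_quad// lee_fin mul1r mul0r !addr0; apply.
  by move=> x; rewrite mul1r mul0r !addr0 sqr_ge0.
(* No uniform integrability is needed for the means: Fatou for the nonnegative
   [e x^2 +- x + 1/(4e)] already gives [+- E q <= e (1 - E q^2)]. *)
have meanY_le (e : R) : 0 < e -> `|mean Y| <= e.
  move=> e0; have sq (x : R) : 0 <= e * x ^+ 2 + x + (4 * e)^-1.
    have -> : e * x ^+ 2 + x + (4 * e)^-1 = e * (x + (2 * e)^-1) ^+ 2 by field; rewrite gt_eqF.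
    by rewrite mulr_ge0 ?sqr_ge0// ltW.
  have Y0 := m2_ge0 Y.
  have h1 : e * m2 Y + 1 * mean Y + (4 * e)^-1 <= e + (4 * e)^-1.
    by rewrite -lee_fin -integral_quad//; apply: fatou_quad => x; rewrite mul1r.
  have h2 : e * m2 Y + (-1) * mean Y + (4 * e)^-1 <= e + (4 * e)^-1.
    rewrite -lee_fin -integral_quad//; apply: fatou_quad => x.
    by have := sq (- x); rewrite sqrrN mulN1r.
  have h3 : 0 <= e * m2 Y by rewrite mulr_ge0// ltW.
  rewrite ler_norml; apply/andP; split; lra.
have meanY : mean Y = 0.
  apply/eqP; rewrite -normr_eq0 eq_le normr_ge0 andbT leNgt; apply/negP => h.
  have := meanY_le (`|mean Y| / 2); rewrite divr_gt0// => /(_ isT); lra.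
have mD (f : {mfun measurableTypeR R >-> R}) : measurable [set u | `|f u| < 1].
  by apply: measurable_lt_set => //; apply: measurableT_comp => //; exact: measurable_funPT.
(* The set |x| < 1 is open: where |Y u| < 1, the approximants eventually satisfy the same
   inequality, as Fatou requires of the indicators. *)
have Dle : fine (unif R [set u | `|Y u| < 1]) <= m.
  rewrite -lee_fin fineK ?fin_num_measure//.
  have -> : unif R [set u | `|Y u| < 1] = (\int[unif R]_u (\1_[set u | `|Y u| < 1] u)%:E)%E.
    by rewrite integral_indic// setIT.
  apply: (@fatou_le _ _ R (unif R) (fun j u => \1_[set u | `|q_ (phi j) u| < 1] u)
    _ (fun j => m + j.+1%:R^-1)) => //.
  - by move=> j; apply: measurable_indic; exact: mD.
  - apply: (negligibleS _ qcvg) => u /= hn hu; apply: hn => e e0.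
    have [u1|u1] := boolP (`|Y u| < 1); last first.
      apply: nearW => j; apply: (@le_trans _ _ 0) => //.
      by rewrite indicE memNset; [rewrite sub0r oppr_le0 ltW|exact/negP].
    have hc : `|q_ (phi j) u| @[j --> \oo] --> `|(Y u : R)| by exact: cvg_norm hu.
    have hd : 0 < (1 - `|Y u|) / 2 by rewrite divr_gt0// subr_gt0.
    apply: filterS (near_ge (cvgN hc) hd) => j /= hj.
    rewrite !indicE mem_set//= mem_set/=; first by rewrite lerBlDr lerDl ltW.
    have lt1 (x y : R) : - y - (1 - y) / 2 <= - x -> y < 1 -> x < 1 by lra.
    exact: lt1 hj u1.
  - move=> j; rewrite integral_indic// setIT.
    rewrite [X in (X <= _)%E](_ : _ = mu (phi j) `]-1, 1[%classic); last first.
      rewrite (qP (phi j)).2// /distribution /pushforward; congr (unif R _).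
      by apply/seteqP; split => u /=; rewrite in_itv/= ltr_norml.
    have [_ _ _ _ h] := muP (phi j); rewrite -[leLHS]fineK ?fin_num_measure// lee_fin.
    apply: (le_trans h); rewrite lerD2l lef_pV2 ?posrE// ler_nat ltnS; exact: phij.
  - rewrite -[X in _ --> X]addr0; apply: cvgD; first exact: cvg_cst.
    exact: cvg_harmonic.
have vY : var Y = m2 Y by rewrite varE// meanY expr0n subr0.
(* With zero variance Y would be almost surely 0, so |Y| < 1 would have probability 1 and m would be
   at least 1. *)
have v0 : 0 < var Y.
  rewrite lt_neqAle var_ge0// andbT; apply/eqP => /esym/(var0_dev Y2); rewrite meanY => h.
  have := inf_PI0_lt1; rewrite ltNge => /negP; apply; apply: le_trans Dle.
  rewrite -lee_fin fineK ?fin_num_measure// -h; apply: le_measure; rewrite ?inE//.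
    by have := measurable_dev_le Y 0; rewrite meanY.
  by move=> u /=; rewrite subr0 => /le_lt_trans; apply.
have Y0 : in_I0 Y by split; [exact/infinitely_divisibleP|].
exists Y; split => //; apply/eqP; rewrite eq_le; apply/andP; split.
  by apply: ge_inf; [exact: has_inf_PI0.2|exists _, _, (unif R), Y].
(* The standard deviation of Y is at most 1, so its own window lies inside (-1, 1); a loss of
   variance in the limit only helps. *)
apply: le_trans Dle; apply: fine_le; rewrite ?fin_num_measure//; first exact: measurable_dev_lt.
apply: le_measure; rewrite ?inE//; first exact: measurable_dev_lt.
move=> u /=; rewrite meanY subr0 => /lt_le_trans; apply.
by rewrite -[leRHS]sqrtr1 ler_wsqrtr// vY.
Qed.

End main.

Theorem theorem2p1 (R : realType) :
  inf (PI0_values R) <= inf (PI_values R) /\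
  0 < inf (PI0_values R) /\
  exists (d : measure_display) (T : measurableType d)
         (P : probability T R) (Y : {RV P >-> R}),
    in_I0 Y /\ inf (PI0_values R) = PI0_prob Y.
Proof.
split; first exact: inf_PI0_le_inf_PI.
split.
  apply: (@lt_le_trans _ _ 64^-1); first by rewrite invr_gt0.
  by apply: lb_le_inf; [exact: has_inf_PI0.1|move=> p; exact: PI0_values_ge].
have [q [q0 qE]] := @inf_PI0_attained R.
by exists _, _, (unif R), q.
Qed.
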